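(* Let $p$ be a prime. The following two statements are equivalent. (i) For every function $\psi:\mathbb{N}\to[0,\infty)$: $\mu_p(W_p(\psi))=1$ if and only if $\sum_{n\in\mathbb{N}}\mu_p(\mathcal{K}_n(\psi))=\infty$. (ii) There exists a constant $C>0$ depending only on $p$ such that for every function $\psi:\mathbb{N}\to[0,\infty)$, $$\mu_p\Big(\bigcup_{n=1}^{\infty}\mathcal{K}_n(\psi)\Big)\geq C\min\Big\{\sum_{n=1}^{\infty}\mu_p(\mathcal{K}_n(\psi)),\,1\Big\}.$$
   Context: $\mathbb{N}$ is the set of positive integers. $\mathbb{Q}_p$ is the field of $p$-adic numbers with its usual absolute value $|\cdot|_p$ (so $|p|_p=p^{-1}$), $\mathbb{Z}_p=\{x\in\mathbb{Q}_p:|x|_p\le1\}$, and $\mu_p$ is the Haar measure on $\mathbb{Q}_p$ with $\mu_p(\mathbb{Z}_p)=1$. For $\psi:\mathbb{N}\to[0,\infty)$ and $n\in\mathbb{N}$, $$\mathcal{K}_n(\psi)=\bigcup_{-n\le a\le n,\ (a,n)=1}\Big\{x\in\mathbb{Z}_p:\Big|x-\frac{a}{n}\Big|_p\le\frac{\psi(n)}{n}\Big\},\qquad W_p(\psi)=\bigcap_{m=1}^{\infty}\bigcup_{n=m}^{\infty}\mathcal{K}_n(\psi),$$ where $a$ ranges over integers and $(a,n)$ is the gcd. *)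

(* Defs.v *)
From HB Require Import structures.
From mathcomp Require Import all_boot all_order all_algebra.
From mathcomp Require Import ring_quotient generic_quotient.
From mathcomp Require Import all_classical all_reals all_analysis.
From mathcomp Require Import zify ring.
Set Implicit Arguments.
Unset Strict Implicit.
Unset Printing Implicit Defensive.
Import Order.TTheory GRing.Theory Num.Theory.
Import numFieldNormedType.Exports.
Local Open Scope classical_set_scope.
Local Open Scope ring_scope.

(* The p-adic absolute value on the rationals. As logn p vanishes when p is not
   prime, rat_pabs p is then the trivial absolute value; this makes Q_p below
   definable for every p : nat without carrying a proof of primality. *)
Definition rat_pabs (p : nat) (q : rat) : rat :=
  if q == 0 then 0
  else (p ^ logn p `|denq q|)%:R / (p ^ logn p `|numq q|)%:R.

Section RatAbs.
Variable p : nat.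
Local Notation D n := ((p ^ logn p n)%:R : rat).

Lemma ppart_gt0 n : 0 < D n.
Proof.
rewrite ltr0n expn_gt0; case: (posnP p) => [->|//]; by rewrite lognE.
Qed.

Lemma ppart_neq0 n : D n != 0.
Proof. by rewrite gt_eqF ?ppart_gt0. Qed.

Lemma ppartM m n : (0 < m)%N -> (0 < n)%N -> D (m * n) = D m * D n.
Proof. by move=> m0 n0; rewrite lognM// expnD natrM. Qed.

Lemma rat_pabsE (a b : int) : a != 0 -> b != 0 ->
  rat_pabs p (a%:~R / b%:~R) = D `|b| / D `|a|.
Proof.
move=> a0 b0; set q := _ / _.
have q0 : q != 0 by rewrite mulf_neq0 ?invr_eq0 ?intr_eq0.
rewrite /rat_pabs (negPf q0).
apply/eqP; rewrite eqr_div ?ppart_neq0// -!ppartM ?absz_gt0 ?denq_eq0 ?numq_eq0//.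
rewrite -!abszM; suff -> : denq q * a = b * numq q by [].
apply/eqP; rewrite -(eqr_int rat) !intrM.
have /eqP : (numq q)%:~R / (denq q)%:~R = a%:~R / b%:~R := divq_num_den q.
rewrite eqr_div ?intr_eq0 ?denq_eq0// => /eqP h.
by rewrite mulrC -h mulrC.
Qed.

Lemma rat_pabs0 : rat_pabs p 0 = 0.
Proof. by rewrite /rat_pabs eqxx. Qed.

Lemma rat_pabs_gt0 q : q != 0 -> 0 < rat_pabs p q.
Proof. by move=> q0; rewrite /rat_pabs (negPf q0) divr_gt0 ?ppart_gt0. Qed.

Lemma rat_pabs_ge0 q : 0 <= rat_pabs p q.
Proof. by have [->|/rat_pabs_gt0/ltW//] := eqVneq q 0; rewrite rat_pabs0. Qed.

Lemma rat_pabs_eq0 q : rat_pabs p q = 0 -> q = 0.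
Proof. by have [//|/rat_pabs_gt0 + e] := eqVneq q 0; rewrite e ltxx. Qed.

Lemma rat_pabs1 : rat_pabs p 1 = 1.
Proof. by rewrite /rat_pabs/= !logn1 expn0 divr1. Qed.

Lemma rat_pabsM x y : rat_pabs p (x * y) = rat_pabs p x * rat_pabs p y.
Proof.
have [->|x0] := eqVneq x 0; first by rewrite mul0r rat_pabs0 mul0r.
have [->|y0] := eqVneq y 0; first by rewrite mulr0 rat_pabs0 mulr0.
rewrite -[x in LHS]divq_num_den -[y in LHS]divq_num_den mulf_div -!intrM.
rewrite rat_pabsE ?mulf_neq0 ?numq_eq0 ?denq_eq0//.
rewrite !abszM !ppartM ?absz_gt0 ?denq_eq0 ?numq_eq0//.
by rewrite /rat_pabs (negPf x0) (negPf y0) mulf_div.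
Qed.

Lemma rat_pabsN x : rat_pabs p (- x) = rat_pabs p x.
Proof.
by rewrite /rat_pabs oppr_eq0 denqN numqN abszN.
Qed.

Lemma rat_pabsB x y : rat_pabs p (x - y) = rat_pabs p (y - x).
Proof. by rewrite -rat_pabsN opprB. Qed.

Lemma rat_pabsV x : rat_pabs p x^-1 = (rat_pabs p x)^-1.
Proof.
have [->|x0] := eqVneq x 0; first by rewrite ?invr0 ?rat_pabs0 ?invr0.
have px0 : rat_pabs p x != 0 by rewrite gt_eqF// rat_pabs_gt0.
by apply: (mulfI px0); rewrite -rat_pabsM !divff// rat_pabs1.
Qed.

Lemma ppart_min (a b : int) : a != 0 -> b != 0 -> a + b != 0 ->
  Num.min (D `|a|) (D `|b|) <= D `|a + b|.
Proof.
move=> a0 b0 ab0; case: (boolP (prime p)) => pp; last first.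
  have l0 n : logn p n = 0%N by rewrite lognE (negPf pp).
  by rewrite !l0 expn0 minxx.
set k := minn (logn p `|a|) (logn p `|b|).
have kab : (p ^ k %| `|(a + b)%R|)%N.
  suff: ((p ^ k)%N%:Z %| a + b)%Z by [].
  by apply: rpredD; rewrite dvdzE/= pfactor_dvdn ?absz_gt0// ?geq_minl ?geq_minr.
rewrite pfactor_dvdn ?absz_gt0// in kab.
have p1 := prime_gt1 pp.
apply: (@le_trans _ _ (p ^ k)%:R); last by rewrite ler_nat leq_exp2l.
by rewrite ge_min !ler_nat !leq_exp2l// /k; lia.
Qed.

Lemma rat_pabsD x y :
  rat_pabs p (x + y) <= Num.max (rat_pabs p x) (rat_pabs p y).
Proof.
have [->|x0] := eqVneq x 0; first by rewrite add0r le_max lexx orbT.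
have [->|y0] := eqVneq y 0; first by rewrite addr0 le_max lexx.
have [->|xy0] := eqVneq (x + y) 0.
  by rewrite rat_pabs0 le_max rat_pabs_ge0.
pose a := numq x * denq y; pose b := numq y * denq x; pose d := denq x * denq y.
have a0 : a != 0 by rewrite mulf_neq0 ?numq_eq0 ?denq_eq0.
have b0 : b != 0 by rewrite mulf_neq0 ?numq_eq0 ?denq_eq0.
have d0 : d != 0 by rewrite mulf_neq0 ?denq_eq0.
have dx : (denq x)%:~R != 0 :> rat by rewrite intr_eq0 denq_eq0.
have dy : (denq y)%:~R != 0 :> rat by rewrite intr_eq0 denq_eq0.
have xE : x = a%:~R / d%:~R.
  by rewrite /a /d !intrM -mulf_div divff// mulr1 divq_num_den.
have yE : y = b%:~R / d%:~R.
  rewrite /b /d !intrM [X in _ / X]mulrC -mulf_div divff//.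
  by rewrite mulr1 divq_num_den.
have xyE : x + y = (a + b)%:~R / d%:~R by rewrite intrD mulrDl -xE -yE.
have ab0 : a + b != 0.
  by apply: contra_neq xy0; rewrite xyE => ->; rewrite mul0r.
rewrite xyE xE yE !rat_pabsE//.
have := ppart_min a0 b0 ab0.
rewrite ge_min => /orP[h|h]; rewrite le_max; apply/orP; [left|right];
  by rewrite ler_pM2l ?ppart_gt0// lef_pV2 ?posrE ?ppart_gt0.
Qed.

End RatAbs.

Definition pcauchy (p : nat) (u : nat -> rat) : Prop :=
  forall e : rat, 0 < e -> exists N : nat,
    forall m n : nat, (N <= m)%N -> (N <= n)%N -> rat_pabs p (u m - u n) < e.

Definition pnull (p : nat) (u : nat -> rat) : Prop :=
  forall e : rat, 0 < e -> exists N : nat,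
    forall n : nat, (N <= n)%N -> rat_pabs p (u n) < e.

Definition pcauchy_pred (p : nat) : {pred nat -> rat} := fun u => `[< pcauchy p u >].

Section Cauchy.
Variable p : nat.
Local Notation abs := (rat_pabs p).

Lemma ltD_max (x y e : rat) : abs x < e -> abs y < e -> abs (x + y) < e.
Proof. by move=> xe ye; rewrite (le_lt_trans (rat_pabsD p x y))// gt_max xe. Qed.

Lemma ltB_max (x y e : rat) : abs x < e -> abs y < e -> abs (x - y) < e.
Proof. by move=> xe ye; apply: ltD_max => //; rewrite rat_pabsN. Qed.

Lemma pcauchy_cst (q : rat) : pcauchy p (fun=> q).
Proof. by move=> e e0; exists 0%N => m n _ _; rewrite subrr rat_pabs0. Qed.

Lemma pcauchyB u v : pcauchy p u -> pcauchy p v -> pcauchy p (u - v).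
Proof.
move=> cu cv e e0; have [N1 h1] := cu e e0; have [N2 h2] := cv e e0.
exists (maxn N1 N2) => m n; rewrite !geq_max => /andP[m1 m2] /andP[n1 n2].
have -> : (u - v) m - (u - v) n = (u m - u n) - (v m - v n) by rewrite !fctE; ring.
by apply: ltB_max; [exact: h1|exact: h2].
Qed.

Lemma pcauchy_bounded u : pcauchy p u ->
  exists2 B : rat, 0 < B & exists N : nat, forall n, (N <= n)%N -> abs (u n) < B.
Proof.
move=> /(_ 1 ltr01)[N h]; exists (Num.max 1 (abs (u N) + 1)); first by rewrite lt_max ltr01.
exists N => n Nn; rewrite -[u n](subrK (u N)).
rewrite (le_lt_trans (rat_pabsD _ _ _))// gt_max !lt_max h//=.
by rewrite ltrDl ltr01 orbT.
Qed.

Lemma pcauchyM u v : pcauchy p u -> pcauchy p v -> pcauchy p (u * v).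
Proof.
move=> cu cv e e0.
have [B B0 [N1 hB]] := pcauchy_bounded cu.
have [C C0 [N2 hC]] := pcauchy_bounded cv.
have [N3 h3] := cu (e / C) (divr_gt0 e0 C0).
have [N4 h4] := cv (e / B) (divr_gt0 e0 B0).
exists (maxn (maxn N1 N2) (maxn N3 N4)) => m n; rewrite !geq_max.
move=> /andP[/andP[m1 m2] /andP[m3 m4]] /andP[/andP[n1 n2] /andP[n3 n4]].
have -> : (u * v) m - (u * v) n = (u m - u n) * v m + (v m - v n) * u n.
  by rewrite !fctE; ring.
apply: ltD_max; rewrite rat_pabsM.
  rewrite -[e](divfK (lt0r_neq0 C0)).
  by apply: ltr_pM; rewrite ?rat_pabs_ge0 ?h3 ?hC.
rewrite -[e](divfK (lt0r_neq0 B0)).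
by apply: ltr_pM; rewrite ?rat_pabs_ge0 ?h4 ?hB.
Qed.

Lemma pcauchy_subring : subring_closed (pcauchy_pred p).
Proof.
split.
- by apply/asboolP; exact: (pcauchy_cst 1).
- by move=> u v /asboolP cu /asboolP cv; apply/asboolP; exact: pcauchyB.
- by move=> u v /asboolP cu /asboolP cv; apply/asboolP; exact: pcauchyM.
Qed.

End Cauchy.

Record pcauchy_seq (p : nat) := PCauchySeq {
  pcauchy_val :> nat -> rat;
  pcauchy_valP : pcauchy_pred p pcauchy_val }.
HB.instance Definition _ p := [isSub for @pcauchy_val p].
HB.instance Definition _ p := [Choice of pcauchy_seq p by <:].
HB.instance Definition _ p := GRing.SubChoice_isSubComNzRing.Build
  (nat -> rat) (pcauchy_pred p) (pcauchy_seq p) (pcauchy_subring p).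

Definition pnull_pred (p : nat) : {pred pcauchy_seq p} :=
  fun u => `[< pnull p u >].

Lemma pnull_ideal p : idealr_closed (@pnull_pred p).
Proof.
split.
- by apply/asboolP => e e0; exists 0%N => n _; rewrite rat_pabs0.
- apply/negP => /asboolP /(_ 1 ltr01)[N /(_ N (leqnn N))].
  by rewrite rat_pabs1 ltxx.
- move=> a u v /asboolP nu /asboolP nv; apply/asboolP => e e0.
  have /pcauchy_bounded[B B0 [N1 hB]] : pcauchy p a by apply/asboolP; case: a.
  have [N2 h2] := nu (e / B) (divr_gt0 e0 B0).
  have [N3 h3] := nv e e0.
  exists (maxn N1 (maxn N2 N3)) => n; rewrite !geq_max => /and3P[n1 n2 n3].
  have -> : pcauchy_val (a * u + v) n = a n * u n + v n by [].
  apply: ltD_max; last exact: h3.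
  rewrite rat_pabsM -[e](divfK (lt0r_neq0 B0)) mulrC.
  by apply: ltr_pM; rewrite ?rat_pabs_ge0 ?h2 ?hB.
Qed.
HB.instance Definition _ p := isIdealr.Build _ (@pnull_pred p) (@pnull_ideal p).

(* Q_p is the completion of the rationals: p-adic Cauchy sequences modulo
   p-adically null sequences. *)
Definition padic (p : nat) : Type := {ideal_quot (@pnull_pred p)}.
HB.instance Definition _ p := GRing.ComNzRing.on (padic p).
(* The values |x|_p are 0 and integral powers of p, so the limit exists in rat
   (pabs_limE and padic_absP below). rat^o carries the usual topology of the
   rationals. *)
Definition padic_abs (p : nat) (x : padic p) : rat :=
  lim ((rat_pabs p (pcauchy_val (repr (x : {ideal_quot _})) n) : rat^o) @[n --> \oo]).

Section PadicField.
Variable p : nat.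
Local Notation abs := (rat_pabs p).
Local Notation Q := {ideal_quot (@pnull_pred p)}.
Implicit Types (u v : pcauchy_seq p) (x y z : padic p).
Local Open Scope quotient_scope.

Lemma rat_pabs_isosceles (a b : rat) : abs a < abs b -> abs (a + b) = abs b.
Proof.
move=> ab; apply/le_anti/andP; split.
  by rewrite (le_trans (rat_pabsD _ _ _))// ge_max lexx ltW.
rewrite leNgt; apply/negP => lt.
have : abs b < abs b; last by rewrite ltxx.
by rewrite -{1}[b](addKr a) addrC; apply: ltB_max.
Qed.

Lemma pcauchy_seqP u : pcauchy p u.
Proof. by apply/asboolP; exact: pcauchy_valP u. Qed.

Lemma pcauchy_dichotomy u : pnull p u \/
  exists2 c : rat, 0 < c & exists N, forall n, (N <= n)%N -> abs (u n) = c.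
Proof.
have [|nn] := pselect (pnull p u); [by left|right].
have [e [e0 he]] : exists e : rat, 0 < e /\
    forall N, exists2 n, (N <= n)%N & e <= abs (u n).
  apply/not_existsP => h; apply: nn => e e0.
  have /not_andP[//|/existsNP[N hN]] := h e.
  exists N => n Nn; rewrite ltNge; apply/negP => en; apply: hN; by exists n.
have [N hN] := @pcauchy_seqP u e e0; have [m Nm em] := he N.
exists (abs (u m)); first exact: lt_le_trans em.
exists N => n Nn; rewrite -[u n](subrK (u m)).
by apply: rat_pabs_isosceles; apply: lt_le_trans em; exact: hN.
Qed.

Lemma padic_eq u v : (\pi u == \pi v :> Q) = `[< pnull p (u - v) >].
Proof. by rewrite -Quotient.idealrBE. Qed.

Lemma padic_eq0 u : (\pi u == 0 :> Q) = `[< pnull p u >].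
Proof. by have := padic_eq u 0; rewrite subr0 rmorph0. Qed.

Lemma pcauchyV u : ~ pnull p u -> pcauchy p (fun n => (u n)^-1).
Proof.
have [//|[c c0 [N1 hc]] _ e e0] := pcauchy_dichotomy u.
have [N2 h2] := @pcauchy_seqP u (e * (c * c)) (mulr_gt0 e0 (mulr_gt0 c0 c0)).
exists (maxn N1 N2) => m n; rewrite !geq_max => /andP[m1 m2] /andP[n1 n2].
have u0 k : (N1 <= k)%N -> u k != 0.
  by move=> /hc uk; apply: contra_eq_neq uk => ->; rewrite rat_pabs0 lt_eqF.
have -> : (u m)^-1 - (u n)^-1 = (u n - u m) * ((u m)^-1 * (u n)^-1).
  by field; rewrite !u0.
rewrite !rat_pabsM !rat_pabsV !hc// -invfM ltr_pdivrMr ?mulr_gt0//.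
exact: h2.
Qed.

Lemma padic_unit (x : Q) : x != 0 -> exists y : Q, y * x = 1.
Proof.
elim/quotW: x => u; rewrite padic_eq0 => /asboolPn nu.
have [//|[c c0 [N hc]]] := pcauchy_dichotomy u.
have cv : pcauchy_pred p (fun n => (u n)^-1) by apply/asboolP; exact: pcauchyV.
exists (\pi_Q (PCauchySeq cv)); apply/eqP; rewrite -rmorphM -(rmorph1 (\pi_Q)).
rewrite padic_eq; apply/asboolP => e e0; exists N => n Nn.
have -> : pcauchy_val (PCauchySeq cv * u - 1) n = (u n)^-1 * u n - 1 by [].
rewrite mulVf ?subrr ?rat_pabs0//.
by apply: contra_eq_neq (hc n Nn) => ->; rewrite rat_pabs0 lt_eqF.
Qed.

Definition padic_inv x : padic p :=
  if pselect (exists y : padic p, y * x = 1) is left h then sval (cid h) else 0.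

Lemma padic_mulVf x : x != 0 -> padic_inv x * x = 1.
Proof.
move=> x0; rewrite /padic_inv; case: pselect => [h|[]]; first by case: cid.
exact: padic_unit x0.
Qed.

Lemma padic_invr0 : padic_inv 0 = 0.
Proof.
rewrite /padic_inv; case: pselect => // h; have [y /eqP] := h.
by rewrite mulr0 eq_sym oner_eq0.
Qed.

HB.instance Definition _ :=
  GRing.ComNzRing_isField.Build (padic p) padic_mulVf padic_invr0.

(* The sequence |u_n|_p tends to c: it tends to 0 or is eventually constant. *)
Definition pabs_lim (u : nat -> rat) (c : rat) : Prop :=
  (pnull p u /\ c = 0) \/
  (0 < c /\ exists N, forall n, (N <= n)%N -> abs (u n) = c).

Lemma pabs_limE u c : pabs_lim u c -> lim ((abs (u n) : rat^o) @[n --> \oo]) = c.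
Proof.
move=> h; apply: cvg_lim; first exact: norm_hausdorff.
apply/cvgrPdist_lt => e e0; case: h => [[/(_ e e0)[N hN] ->]|[c0 [N hN]]].
  by exists N => // n /= /hN; rewrite sub0r normrN ger0_norm ?rat_pabs_ge0.
by exists N => // n /= /hN ->; rewrite subrr normr0.
Qed.

Lemma pabs_lim_ex u : exists c, pabs_lim u c.
Proof.
by have [nu|[c c0 h]] := pcauchy_dichotomy u; [exists 0; left|exists c; right].
Qed.

Lemma padic_absP u : pabs_lim u (padic_abs (\pi_Q u)).
Proof.
set v := repr (\pi_Q u).
have /asboolP uv : `[< pnull p (v - u) >] by rewrite -padic_eq reprK.
have [c vc] := pabs_lim_ex v.
suff : pabs_lim u c by rewrite /padic_abs -/v (pabs_limE vc).
have uE n : u n = v n - pcauchy_val (v - u) n.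
  by have -> : pcauchy_val (v - u) n = v n - u n by []; rewrite subKr.
case: vc => [[nv ->]|[c0 [N hN]]]; [left|right]; split => //.
  move=> e e0; have [N1 h1] := nv e e0; have [N2 h2] := uv e e0.
  exists (maxn N1 N2) => n; rewrite geq_max => /andP[n1 n2].
  by rewrite uE; apply: ltB_max; [exact: h1|exact: h2].
have [N2 h2] := uv c c0; exists (maxn N N2) => n; rewrite geq_max => /andP[n1 n2].
rewrite uE addrC rat_pabs_isosceles ?hN// rat_pabsN; exact: h2.
Qed.

Lemma padic_abs0 : padic_abs (0 : padic p) = 0.
Proof.
have := @padic_absP 0; rewrite rmorph0 => -[[_ //]|[c0 [N /(_ N (leqnn N))]]].
by rewrite rat_pabs0.
Qed.

Lemma padic_abs_ge0 x : 0 <= padic_abs x.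
Proof. by elim/quotW: (x : Q) => u; have [[_ ->]|[/ltW]] := padic_absP u. Qed.

Lemma padic_abs_eq0 x : padic_abs x = 0 -> x = 0.
Proof.
elim/quotW: (x : Q) => u; have [[nu _ _]|[+ _ e]] := padic_absP u.
  by apply/eqP; rewrite padic_eq0; apply/asboolP.
by rewrite e ltxx.
Qed.

Lemma padic_absN x : padic_abs (- x) = padic_abs x.
Proof.
elim/quotW: (x : Q) => u.
have h := padic_absP u; have := padic_absP (- u); rewrite rmorphN => h'.
rewrite -(pabs_limE h) -(pabs_limE h').
suff -> : (fun n => abs ((- u) n)) = (fun n => abs (u n)) by [].
by apply/funext => n; exact: rat_pabsN.
Qed.

Lemma padic_absD x y :
  padic_abs (x + y) <= Num.max (padic_abs x) (padic_abs y).
Proof.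
elim/quotW: (x : Q) => u; elim/quotW: (y : Q) => v.
have near w (e : rat) : padic_abs (\pi_Q w) < e ->
    exists N, forall n, (N <= n)%N -> abs (w n) < e.
  have [[nw ->]|[_ [N hN]] we] := padic_absP w; first exact: nw.
  by exists N => n /hN ->.
have := padic_absP (u + v); rewrite rmorphD.
case=> [[_ ->]|[c0 [N hN]]]; first by rewrite le_max padic_abs_ge0.
rewrite leNgt gt_max; apply/negP => /andP[/near[N1 h1] /near[N2 h2]].
set n := maxn N (maxn N1 N2).
have : abs (u n + v n) < padic_abs (\pi_Q u + \pi_Q v).
  by apply: ltD_max; [apply: h1|apply: h2]; rewrite /n; lia.
by rewrite -[u n + v n]/(pcauchy_val (u + v) n) hN ?ltxx// /n; lia.
Qed.

Lemma padic_absM x y : padic_abs (x * y) = padic_abs x * padic_abs y.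
Proof.
elim/quotW: (x : Q) => u; elim/quotW: (y : Q) => v.
have hu := padic_absP u; have hv := padic_absP v.
have := padic_absP (u * v); rewrite rmorphM => h.
have [u0|u0] := eqVneq (\pi_Q u) 0; first by rewrite u0 mul0r padic_abs0 mul0r.
have [v0|v0] := eqVneq (\pi_Q v) 0; first by rewrite v0 mulr0 padic_abs0 mulr0.
case: hu => [[nu _]|[_ [N1 h1]]].
  by move: u0; rewrite padic_eq0 => /asboolPn.
case: hv => [[nv _]|[_ [N2 h2]]].
  by move: v0; rewrite padic_eq0 => /asboolPn.
have uv n : (maxn N1 N2 <= n)%N -> abs ((u * v) n) =
    padic_abs (\pi_Q u) * padic_abs (\pi_Q v).
  rewrite geq_max => /andP[n1 n2].
  by rewrite -[(u * v) n]/(u n * v n) rat_pabsM h1 ?h2.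
have w0 : \pi_Q u * \pi_Q v != 0 by exact: (@mulf_neq0 (padic p)).
case: h => [[nuv _]|[_ [N hN]]].
  by move: w0; rewrite -rmorphM padic_eq0 => /asboolPn.
by rewrite -(hN (maxn N (maxn N1 N2))) ?uv//; lia.
Qed.

Definition padic_of_rat (q : rat) : padic p :=
  \pi_Q (PCauchySeq (asboolT (@pcauchy_cst p q))).

Lemma padic_of_rat_zmod_morphism : zmod_morphism padic_of_rat.
Proof. by move=> a b; rewrite /padic_of_rat -rmorphB; congr (\pi_Q _); apply: val_inj. Qed.

Lemma padic_of_rat_monoid_morphism : monoid_morphism padic_of_rat.
Proof.
split; first by rewrite -(rmorph1 (\pi_Q)); congr (\pi_Q _); apply: val_inj.
by move=> a b; rewrite /padic_of_rat -rmorphM; congr (\pi_Q _); apply: val_inj.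
Qed.

HB.instance Definition _ := GRing.isZmodMorphism.Build rat (padic p) padic_of_rat
  padic_of_rat_zmod_morphism.
HB.instance Definition _ := GRing.isMonoidMorphism.Build rat (padic p) padic_of_rat
  padic_of_rat_monoid_morphism.

Lemma padic_abs_rat (q : rat) : padic_abs (ratr q : padic p) = rat_pabs p q.
Proof.
rewrite -(fmorph_eq_rat padic_of_rat).
have := padic_absP (PCauchySeq (asboolT (@pcauchy_cst p q))).
case=> [[nu ->]|[_ [N /(_ N (leqnn N)) <- //]]].
apply/esym/le_anti; rewrite rat_pabs_ge0 andbT leNgt; apply/negP.
by move=> /nu[N /(_ N (leqnn N))]; rewrite ltxx.
Qed.

(* The p-adic absolute value does not make Q_p a normedZmodType, since
   |x *+ n| = |x| *+ n fails, so the topology comes from the metric. *)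
Definition padic_dist (x y : padic p) : rat := padic_abs (x - y).

Lemma padic_distxx x : padic_dist x x = 0.
Proof. by rewrite /padic_dist subrr padic_abs0. Qed.

Lemma padic_dist_eq0 x y : padic_dist x y = 0 -> x = y.
Proof. by move=> /padic_abs_eq0 /eqP; rewrite subr_eq0 => /eqP. Qed.

Lemma padic_dist_sym x y : padic_dist x y = padic_dist y x.
Proof. by rewrite /padic_dist -padic_absN opprB. Qed.

Lemma padic_dist_triangle y x z :
  padic_dist x z <= padic_dist x y + padic_dist y z.
Proof.
rewrite /padic_dist -(subrKA y x); apply: (le_trans (padic_absD _ _)).
by rewrite ge_max lerDl lerDr !padic_abs_ge0.
Qed.

HB.instance Definition _ := isMetric.Build rat (padic p)
  padic_distxx padic_dist_eq0 padic_dist_sym padic_dist_triangle.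
HB.instance Definition _ := isPointed.Build (padic p) 0.

End PadicField.

Definition borel_padic (p : nat) := g_sigma_algebraType (@open (padic p)).

Definition padic_int (p : nat) : set (padic p) := [set x | padic_abs x <= 1].
Arguments padic_int : clear implicits.

(* A Borel measure that is translation invariant and gives Z_p mass 1 is finite
   on balls (a ball is a translate of some p^k Z_p), hence on compact sets, and
   regular since Q_p is locally compact and second countable: it is the Haar
   measure normalized on Z_p. *)
Definition padic_haar (R : realType) (p : nat)
    (mu : {measure set (borel_padic p) -> \bar R}) : Prop :=
  (forall (x : padic p) (A : set (borel_padic p)),
     measurable A -> mu [set x + y | y in (A : set (padic p))] = mu A) /\
  mu (padic_int p) = 1%E.

Definition approx_set (R : realType) (p : nat) (psi : nat -> R) (n : nat)
    : set (padic p) :=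
  \bigcup_(a in [set a : int | - n%:Z <= a <= n%:Z /\ gcdz a n%:Z = 1])
    [set x | padic_int p x /\
             ratr (padic_abs (x - a%:~R / n%:R)) <= psi n / n%:R].
Arguments approx_set {R} p psi n _.

Definition approx_limsup (R : realType) (p : nat) (psi : nat -> R)
    : set (padic p) :=
  \bigcap_(m in [set m : nat | (1 <= m)%N])
    \bigcup_(n in [set n : nat | (m <= n)%N]) approx_set p psi n.
Arguments approx_limsup {R} p psi _.

(* Main.v *)
Require Import Defs.
From HB Require Import structures.
From mathcomp Require Import all_boot all_order all_algebra.
From mathcomp Require Import generic_quotient.
From mathcomp Require Import all_classical all_reals all_analysis.
From mathcomp Require Import zify ring lra.
Set Implicit Arguments.
Unset Strict Implicit.
Unset Printing Implicit Defensive.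
Import Order.TTheory GRing.Theory Num.Theory.
Import numFieldNormedType.Exports.

(* (ii) implies (i): apply (ii) to the tails of psi / p^t, with the n divisible
   by p removed and psi n truncated at n. The limsup sets V_t all have measure
   at least C, hence so does their intersection V. Zooming in on a ball
   i + p^j Z_p sends a / n to (a - i n) / (p^j n), whose numerator still lies in
   [-n, n] when 0 <= i < p^j, so it maps V into itself. Hence V has the same
   density in every ball, V is independent of itself, and mu V = 1.

   (i) implies (ii): suppose (ii) fails. Multiplying all radii by p^t multiplies
   the measure of a union by at most p^t, while the measure of K_n grows by a
   factor of order p^t until it saturates. The latter holds because the integers
   of [0, n) coprime to n meet at least min(phi(n), m) / 7 residue classes
   modulo m, by the Cauchy-Schwarz inequality and a bound on the number of pairs
   of congruent ones. So a family violating (ii) with a tiny constant can be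
   dilated to one with total measure bounded below and a union of tiny measure.
   Gluing such families gives a divergent series whose limsup set is not full. *)

(** * Integers coprime to n in residue classes *)

(** The Chinese remainder bijection [h], whose inverse reduces modulo [m1] and [m2], reindexes the
    sum; periodicity then separates the two factors. *)
Lemma sum_chinese (m1 m2 : nat) (f g : nat -> nat) : coprime m1 m2 ->
  0 < m1 -> 0 < m2 ->
  (forall a, f (a %% m1) = f a) -> (forall a, g (a %% m2) = g a) ->
  \sum_(a < m1 * m2) f a * g a = (\sum_(a < m1) f a) * (\sum_(a < m2) g a).
Proof.
move=> co m10 m20 hf hg.
have m0 : 0 < m1 * m2 by rewrite muln_gt0 m10.
pose h (ij : 'I_m1 * 'I_m2) : 'I_(m1 * m2) :=
  Ordinal (ltn_pmod (chinese m1 m2 ij.1 ij.2) m0).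
pose h' (a : 'I_(m1 * m2)) : 'I_m1 * 'I_m2 :=
  (Ordinal (ltn_pmod a m10), Ordinal (ltn_pmod a m20)).
have hh' : cancel h h'.
  move=> [i j]; congr pair; apply: val_inj => /=.
    by rewrite modn_dvdm ?dvdn_mulr// chinese_modl// modn_small.
  by rewrite modn_dvdm ?dvdn_mull// chinese_modr// modn_small.
have h'h : cancel h' h.
  by move=> a; apply: val_inj => /=; rewrite -chinese_mod// modn_small.
rewrite big_distrlr/= pair_big/= (reindex h); last by exists h' => x _.
apply: eq_bigr => -[i j] _ /=; congr (_ * _).
  by rewrite -hf modn_dvdm ?dvdn_mulr// chinese_modl// hf.
by rewrite -hg modn_dvdm ?dvdn_mull// chinese_modr// hg.
Qed.

(** Only [a] is confined to [0, n), while [a + d] may exceed [n]: pairs are counted cyclically. This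
    makes the count multiplicative over coprime factors of [n], and an upper bound for the pairs at
    distance [d] inside [0, n). *)
Definition unit_pairs (n d : nat) : nat :=
  \sum_(a < n) (coprime n a && coprime n (a + d)).

Lemma unit_pairs_coprime m1 m2 d : coprime m1 m2 -> 0 < m1 -> 0 < m2 ->
  unit_pairs (m1 * m2) d = unit_pairs m1 d * unit_pairs m2 d.
Proof.
move=> co m10 m20; rewrite /unit_pairs.
rewrite -(@sum_chinese _ _ (fun a => coprime m1 a && coprime m1 (a + d) : nat)
  (fun a => coprime m2 a && coprime m2 (a + d) : nat))//.
- by apply: eq_bigr => a _; rewrite !coprimeMl mulnb; congr nat_of_bool; do 4 case: coprime.
- by move=> a; rewrite coprime_modr -(coprime_modr _ (a %% _ + d)) modnDml coprime_modr.
- by move=> a; rewrite coprime_modr -(coprime_modr _ (a %% _ + d)) modnDml coprime_modr.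
Qed.

Lemma unit_pairs_le_totient n d : unit_pairs n d <= totient n.
Proof.
rewrite totient_count_coprime big_mkord; apply: leq_sum => a _.
by case: (coprime n a); rewrite //= leq_b1.
Qed.

Lemma sum_dvdn_addr q e d : 0 < q ->
  \sum_(a < q * e) (q %| a + d) = e.
Proof.
move=> q0.
have base x : \sum_(i < q) (q %| i + x) = 1.
  have E : (x + (q - x %% q)) %% q = 0.
    by rewrite -modnDml subnKC ?modnn// ltnW// ltn_pmod.
  pose i0 := Ordinal (ltn_pmod (q - x %% q) q0).
  rewrite (bigD1 i0)//= /dvdn modnDml (addnC _ x) E eqxx big1 ?addn0// => i ni.
  case: eqP => // h; case/eqP: ni; apply: val_inj => /=.
  have : i + x = (q - x %% q) %% q + x %[mod q].
    by rewrite h modnDml (addnC _ x) E.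
  by move/eqP; rewrite eqn_modDr modn_mod (modn_small (ltn_ord i)) => /eqP.
elim: e => [|e IH]; first by rewrite muln0 big_ord0.
rewrite mulnS addnC big_split_ord/= IH -[in RHS]addn1; congr (_ + _).
rewrite -[RHS](base d); apply: eq_bigr => i _.
by rewrite -addnA dvdn_addr// dvdn_mulr.
Qed.

(** Among the [q ^ e] residues, [q ^ e.-1] have [a] divisible by [q] and as many have [a + d]
    divisible by [q]; the two sets are disjoint because [q] does not divide [d]. *)
Lemma unit_pairs_pfactor q e d : prime q -> 0 < e -> ~~ (q %| d) ->
  unit_pairs (q ^ e) d = (q - 2) * q ^ e.-1.
Proof.
move=> pq e0 qd; have q1 := prime_gt1 pq.
have qeE : q ^ e = q * q ^ e.-1 by rewrite -expnS prednK.
have cE a : coprime (q ^ e) a = ~~ (q %| a) by rewrite coprime_pexpl// prime_coprime.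
have : unit_pairs (q ^ e) d + \sum_(a < q ^ e) (q %| a + 0) +
    \sum_(a < q ^ e) (q %| a + d) = q ^ e.
  rewrite /unit_pairs -!big_split/= -[RHS]card_ord -sum1_card.
  apply: eq_bigr => a _; rewrite !cE addn0.
  case: (boolP (q %| a)) => qa /=; first by rewrite dvdn_addr// (negPf qd).
  by case: (q %| _).
rewrite qeE !sum_dvdn_addr ?prime_gt0//.
by rewrite mulnBl; lia.
Qed.

Lemma gcdn_mul_coprime a b d : coprime a b ->
  gcdn (a * b) d = gcdn a d * gcdn b d.
Proof.
move=> ab; apply/eqP; rewrite eqn_dvd; apply/andP; split; last first.
  rewrite Gauss_dvd; last first.
    by rewrite (coprime_dvdl (dvdn_gcdl _ _))// (coprime_dvdr (dvdn_gcdl _ _)).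
  rewrite !dvdn_gcd !dvdn_gcdr !andbT; apply/andP; split.
    by rewrite dvdn_mulr// dvdn_gcdl.
  by rewrite dvdn_mull// dvdn_gcdl.
rewrite muln_gcdl !muln_gcdr !dvdn_gcd dvdn_gcdl/=.
by rewrite dvdn_mull ?dvdn_gcdr//= !dvdn_mulr ?dvdn_gcdr.
Qed.

(* Both sides are multiplicative in [n]; when [n] is a power of a prime [q] not
   dividing [d], this is [q * (q - 2) <= (q - 1) ^ 2]. *)
Lemma unit_pairs_le n d : 0 < n ->
  n * unit_pairs n d * totient (gcdn n d) <= totient n ^ 2 * gcdn n d.
Proof.
elim/ltn_ind: n => n IH n0.
have [n1|n1] := leqP n 1.
  have -> : n = 1 by lia.
  by rewrite gcd1n /unit_pairs big_ord1 !coprime1n.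
pose q := pdiv n; have pq : prime q := pdiv_prime n1.
pose e := logn q n; have e0 : 0 < e by rewrite logn_gt0 pi_pdiv.
have [m qm nE] : exists2 m, coprime q m & n = q ^ e * m.
  have [m cm nE] := pfactor_coprime pq n0.
  by exists m => //; rewrite mulnC.
have m0 : 0 < m by move: n0; rewrite nE muln_gt0 => /andP[].
have q1 := prime_gt1 pq.
have qe1 : 1 < q ^ e by rewrite -(exp1n e) ltn_exp2r.
have cqm : coprime (q ^ e) m by rewrite coprime_pexpl.
have mn : m < n by rewrite nE ltn_Pmull.
have IHm := IH m mn m0.
have gE : gcdn n d = gcdn (q ^ e) d * gcdn m d.
  by rewrite nE gcdn_mul_coprime.
rewrite gE totient_coprime; last first.
  by rewrite (coprime_dvdl (dvdn_gcdl _ _))// (coprime_dvdr (dvdn_gcdl _ _)).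
rewrite nE totient_coprime// unit_pairs_coprime//; last lia.
suff base : q ^ e * unit_pairs (q ^ e) d * totient (gcdn (q ^ e) d) <=
            totient (q ^ e) ^ 2 * gcdn (q ^ e) d.
  rewrite expnMn; have := leq_mul base IHm; congr (_ <= _); ring.
have [qd|nqd] := boolP (q %| d); last first.
  have -> : gcdn (q ^ e) d = 1.
    by apply/eqP; rewrite -/(coprime _ _) coprime_pexpl// prime_coprime.
  rewrite !muln1 unit_pairs_pfactor// totient_pfactor//.
  rewrite -{1}(prednK e0) expnS.
  have : q * (q - 2) <= q.-1 * q.-1 by nia.
  move=> /leq_mul /(_ (leqnn (q ^ e.-1 * q ^ e.-1))); nia.
have [i i0 iE] : exists2 i, 0 < i & gcdn (q ^ e) d = q ^ i.
  have /(dvdn_pfactor _ _ pq)[i _ iE] := dvdn_gcdl (q ^ e) d.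
  exists i => //; case: i iE => // /eqP; rewrite expn0 -/(coprime _ _).
  by rewrite coprime_pexpl// prime_coprime// qd.
(* When [q] divides [d], the trivial bound by the totient suffices, since [totient (q ^ i) / q ^ i]
   is the same for all [i > 0]. *)
rewrite iE; apply: (@leq_trans (q ^ e * totient (q ^ e) * totient (q ^ i))).
  by rewrite leq_mul2r leq_mul2l unit_pairs_le_totient !orbT.
rewrite !totient_pfactor// -[in leqLHS](prednK e0) -[in leqRHS](prednK i0) !expnS.
by rewrite expn0; apply/eq_leq; ring.
Qed.

Lemma sum_dvdn (V : nmodType) (q J : nat) (F : nat -> V) : 0 < q ->
  (\sum_(1 <= j < J.+1 | (q %| j)%N) F j = \sum_(1 <= i < (J %/ q).+1) F (q * i)%N)%R.
Proof.
move=> q0; elim: J => [|J IH]; first by rewrite div0n !big_nil.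
rewrite big_mkcond big_nat_recr//= -big_mkcond/= IH divnS//.
case: ifP => qJ; last by rewrite addr0.
rewrite add1n [RHS]big_nat_recr//=; congr (_ + F _)%R.
have : J.+1 %/ q = (J %/ q).+1 by rewrite divnS// qJ.
by move=> <-; rewrite mulnC divnK.
Qed.

(** * Averaging the correlation bound over the shifts *)

Local Open Scope ring_scope.

Lemma divn_totient_prod (g : nat) : (0 < g)%N ->
  g%:R / (totient g)%:R = \prod_(q <- primes g) (1 + q.-1%:R^-1) :> rat.
Proof.
move=> g0; rewrite totientE// {1}[g]prod_prime_decomp// prime_decompE big_map/=.
rewrite !natr_prod -prodf_div big_seq [RHS]big_seq; apply: eq_bigr => q.
rewrite mem_primes => /and3P[pq _ qg]; have q1 := prime_gt1 pq.
have e0 : (0 < logn q g)%N by rewrite logn_gt0 mem_primes pq g0.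
rewrite -{1}(prednK e0) expnS !natrM -mulf_div divff ?mulr1; last first.
  by rewrite pnatr_eq0 -lt0n expn_gt0 ltnW.
rewrite -{1}(prednK (ltnW q1)) -[in X in X / _]addn1 natrD mulrDl divff ?div1r//.
by rewrite pnatr_eq0; lia.
Qed.

(* A further prime [q] only affects the multiples of [q], which are as many as
   the integers up to [J / q]. *)
Lemma sum_prod_primes (Q : seq nat) (J : nat) : all prime Q -> uniq Q ->
  \sum_(1 <= j < J.+1) \prod_(q <- Q | (q %| j)%N) (1 + q.-1%:R^-1) <=
  J%:R * \prod_(q <- Q) (1 + (q * q.-1)%:R^-1) :> rat.
Proof.
elim: Q J => [|q Q IH] J /=.
  move=> _ _; rewrite big_nil mulr1; under eq_bigr do rewrite big_nil.
  by rewrite big_const_nat subSS subn0 iter_addr_0.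
move=> /andP[pq aQ] /andP[qQ uQ]; have q0 := prime_gt0 pq.
have q1 : (0 < q.-1)%N by have := prime_gt1 pq; lia.
pose F (j : nat) : rat := \prod_(q <- Q | (q %| j)%N) (1 + q.-1%:R^-1).
have -> : \sum_(1 <= j < J.+1) \prod_(q <- q :: Q | (q %| j)%N) (1 + q.-1%:R^-1) =
    \sum_(1 <= j < J.+1) F j +
    q.-1%:R^-1 * \sum_(1 <= j < J.+1 | (q %| j)%N) F j :> rat.
  rewrite mulr_sumr [in X in _ = _ + X]big_mkcond -big_split/=.
  apply: eq_bigr => j _; rewrite big_cons; case: ifP => _; last by rewrite addr0.
  by rewrite mulrDl mul1r.
rewrite sum_dvdn//.
have -> : \sum_(1 <= i < (J %/ q).+1) F (q * i)%N = \sum_(1 <= i < (J %/ q).+1) F i.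
  apply: eq_bigr => i _; rewrite /F big_seq_cond [RHS]big_seq_cond.
  apply: eq_bigl => r; case: (boolP (r \in Q)) => //= rQ.
  have pr : prime r by exact: (allP aQ).
  rewrite Euclid_dvdM// dvdn_prime2//.
  by case: eqVneq => // rq; rewrite rq (negPf qQ) in rQ.
rewrite big_cons; set P := \prod_(j <- Q) _.
have P0 : 0 <= P by apply: prodr_ge0 => i _; rewrite addr_ge0// invr_ge0.
have h1 := IH J aQ uQ; have h2 := IH (J %/ q)%N aQ uQ.
apply: (le_trans (lerD h1 (ler_wpM2l _ h2))); first by rewrite invr_ge0.
rewrite -/P mulrDl mul1r mulrDr lerD2l !mulrA ler_wpM2r//.
rewrite natrM invfM (mulrC q%:R^-1) mulrCA ler_pM2l ?invr_gt0 ?ltr0n//.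
by rewrite ler_pdivlMr ?ltr0n// -natrM ler_nat leq_trunc_div.
Qed.

(** All factors are at least 1, so the primes may be replaced by all integers from 2 up to their
    maximum, for which a telescoping bound is available. *)
Lemma prod_primes_le3 (Q : seq nat) : all prime Q -> uniq Q ->
  \prod_(q <- Q) (1 + (q * q.-1)%:R^-1) <= 3 :> rat.
Proof.
move=> aQ uQ; pose N := (\max_(q <- Q) q).+1.
have F1 i : 1 <= 1 + (i * i.-1)%:R^-1 :> rat by rewrite lerDl invr_ge0.
apply: (@le_trans _ _ (\prod_(2 <= i < N.+1) (1 + (i * i.-1)%:R^-1))).
  have QE : perm_eq Q [seq i <- index_iota 2 N.+1 | i \in Q].
    apply: uniq_perm; rewrite ?filter_uniq ?iota_uniq// => i.
    rewrite mem_filter mem_index_iota; case: (boolP (i \in Q)) => //= iQ.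
    by rewrite prime_gt1 ?(allP aQ)// ltnS leqW// (leq_bigmax_seq i).
  rewrite (perm_big _ QE)/= big_filter big_mkcond; apply: ler_prod => i _.
  by case: ifP => _; rewrite ?ler01 ?lexx ?F1 ?(le_trans ler01 (F1 i)).
have : (0 < N)%N by [].
move: N => N N0.
(* [1 + 1 / (i * (i - 1)) <= h i / h (i - 1)] for [h i = i / (i + 2)], so the
   product telescopes. *)
apply: (@le_trans _ _ (3 * (N%:R / (N + 2)%:R))); last first.
  rewrite -[leRHS]mulr1 ler_pM2l// ler_pdivrMr ?ltr0n ?addn2// mul1r ler_nat; lia.
elim: N N0 => // -[_ _|N IH _]; first by rewrite big_nil.
rewrite big_nat_recr//=; apply: (le_trans (ler_wpM2r _ (IH isT))).
  by rewrite (le_trans ler01).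
rewrite -mulrA ler_pM2l//.
have x0 : 0 <= N%:R :> rat by rewrite ler0n.
rewrite !natrD natrM -!natr1; move: x0; set x : rat := N%:R => x0.
have h1 : x + 1 != 0 by rewrite gt_eqF//; lra.
have h2 : x + 1 + 1 != 0 by rewrite gt_eqF//; lra.
have h3 : x + 1 + 2 != 0 by rewrite gt_eqF//; lra.
have h4 : x + 1 + 1 + 2 != 0 by rewrite gt_eqF//; lra.
rewrite -subr_ge0.
have -> : (x + 1 + 1) / (x + 1 + 1 + 2) -
  (x + 1) / (x + 1 + 2) * (1 + ((x + 1 + 1) * (x + 1))^-1) =
  x / ((x + 1 + 1 + 2) * (x + 1 + 2) * (x + 1 + 1)).
  by field; rewrite h1 h2 h3 h4.
by rewrite divr_ge0// !mulr_ge0// ?addr_ge0.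
Qed.

(** By [unit_pairs_le] each term is at most [totient n ^ 2 / n] times [g / totient g] with
    [g = gcdn n j], where [m] drops out by coprimality. The Euler product turns [g / totient g] into
    a product over the primes dividing both [n] and [j], whose mean over [j] is at most 3. *)
Lemma sum_unit_pairs (n m J : nat) : (0 < n)%N -> coprime n m ->
  (n * \sum_(1 <= j < J.+1) unit_pairs n (j * m) <= 3 * J * totient n ^ 2)%N.
Proof.
move=> n0 nm; rewrite -(ler_nat rat) natrM natr_sum mulr_sumr.
have t0 : 0 < (totient n)%:R :> rat by rewrite ltr0n totient_gt0.
apply: (@le_trans _ _ (\sum_(1 <= j < J.+1) (totient n ^ 2)%:R *
   \prod_(q <- primes n | (q %| j)%N) (1 + q.-1%:R^-1))).
  apply: ler_sum => j _.
  have g0 : (0 < gcdn n j)%N by rewrite gcdn_gt0 n0.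
  have -> : \prod_(q <- primes n | (q %| j)%N) (1 + q.-1%:R^-1) =
      (gcdn n j)%:R / (totient (gcdn n j))%:R :> rat.
    rewrite divn_totient_prod// -big_filter; apply: perm_big.
    apply: uniq_perm; rewrite ?filter_uniq ?primes_uniq// => q.
    rewrite mem_filter !mem_primes g0 n0 dvdn_gcd.
    by case: (prime q); rewrite ?andbF//= andbC.
  rewrite mulrA ler_pdivlMr ?ltr0n ?totient_gt0// -!natrM ler_nat.
  have := unit_pairs_le (j * m) n0.
  by rewrite Gauss_gcdl.
rewrite -mulr_sumr [in leRHS]natrM [leRHS]mulrC ler_wpM2l ?ler0n//.
have aQ : all prime (primes n) by apply/allP => q; rewrite mem_primes => /andP[].
apply: (le_trans (sum_prod_primes _ aQ (primes_uniq n))).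
by rewrite natrM mulrC ler_wpM2r// prod_primes_le3// primes_uniq.
Qed.

(* Second moment count of the residue classes that are hit *)
Local Close Scope ring_scope.

(** Cauchy-Schwarz, from [2 * F i * F j <= F i ^ 2 + F j ^ 2] summed over all pairs. *)
Lemma sum_sqr_le_card (I : finType) (A : {set I}) (F : I -> nat) :
  (\sum_(i in A) F i) ^ 2 <= #|A| * \sum_(i in A) F i ^ 2.
Proof.
rewrite -(@leq_pmul2l 2)// -mulnn big_distrlr/= !big_distrr/=.
apply: (@leq_trans (\sum_(i in A) \sum_(j in A) (F i ^ 2 + F j ^ 2))).
  apply: leq_sum => i _; rewrite big_distrr/=; apply: leq_sum => j _.
  by rewrite nat_Cauchy.
under eq_bigr do rewrite big_split/= sum_nat_const.
rewrite big_split/= sum_nat_const -!big_distrr/= addnn -mul2n.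
by rewrite big_distrr/= big_distrr.
Qed.

(** The diagonal contributes [totient n]. By symmetry the rest is twice the number of pairs with
    [a < b], for which [b = a + j * m] with [1 <= j <= n %/ m]. *)
Lemma sum_congr_pairs n m : 0 < m ->
  \sum_(a < n) \sum_(b < n)
    (coprime n a && coprime n b && (a %% m == b %% m)) <=
  totient n + 2 * \sum_(1 <= j < (n %/ m).+1) unit_pairs n (j * m).
Proof.
move=> m0; pose X a b := coprime n a && coprime n b && (a %% m == b %% m).
have XC a b : X a b = X b a by rewrite /X eq_sym [coprime n a && _]andbC.
pose S := \sum_(a < n) \sum_(b < n) ((a < b) && X a b).
have SC : \sum_(a < n) \sum_(b < n) ((b < a) && X a b) = S.
  by rewrite exchange_big/=; apply: eq_bigr => a _; apply: eq_bigr => b _; rewrite XC.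
have SE : S <= \sum_(1 <= j < (n %/ m).+1) unit_pairs n (j * m).
  rewrite /unit_pairs exchange_big/=; apply: leq_sum => a _.
  apply: (@leq_trans (\sum_(b < n) \sum_(1 <= j < (n %/ m).+1)
      ((b == a + j * m :> nat) && (coprime n a && coprime n (a + j * m))))).
    apply: leq_sum => b _; case: (boolP (_ && _)) => //=.
    move=> /andP[ab /andP[/andP[ca cb] /eqP mab]].
    have d : m %| b - a by rewrite -eqn_mod_dvd ?(ltnW ab)// mab.
    have bE : b = a + (b - a) %/ m * m :> nat by rewrite divnK// subnKC// ltnW.
    have j0 : 0 < (b - a) %/ m by rewrite divn_gt0// dvdn_leq// subn_gt0.
    have jn : (b - a) %/ m < (n %/ m).+1.
      by rewrite ltnS leq_div2r// (leq_trans (leq_subr _ _))// ltnW.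
    rewrite (big_rem ((b - a) %/ m))/=; last by rewrite mem_index_iota j0.
    by rewrite -bE eqxx ca cb.
  rewrite exchange_big/=; apply: leq_sum => j _.
  case: (boolP (coprime n a && _)) => h; last by rewrite big1// => b _; rewrite andbF.
  under eq_bigr do rewrite andbT.
  have [abn|abn] := ltnP (a + j * m) n; last first.
    by rewrite big1// => b _; case: eqP => // e; have := ltn_ord b; lia.
  rewrite (bigD1 (Ordinal abn))//= eqxx big1// => b /negPf nb.
  by rewrite -val_eqE/= in nb; rewrite nb.
apply: (@leq_trans (totient n + 2 * S)); last by rewrite leq_add2l leq_mul2l SE orbT.
rewrite mul2n -addnn -{1}SC /S totient_count_coprime big_mkord -!big_split/=.
apply: leq_sum => a _.
have -> : (coprime n a : nat) = \sum_(b < n) ((b == a) && coprime n a).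
  rewrite (bigD1 a)//= eqxx big1 ?addn0// => b /negPf nb.
  by rewrite -val_eqE/= in nb; rewrite -val_eqE/= nb.
rewrite -!big_split/=; apply: leq_sum => b _.
have [ab|ba|/val_inj ->] := ltngtP a b.
- by rewrite -/(X a b); case: (X a b) => //=; rewrite ?addn0 ?addn1 ?addnA ?addn1.
- by rewrite -/(X a b); case: (X a b) => //=; rewrite ?addn0 ?addn1 ?addnA ?addn1.
- by rewrite !eqxx andbT andbb ?addn0 leqnn.
Qed.

Definition residue_hit (n m r : nat) : bool :=
  [exists a : 'I_n, coprime n a && (a %% m == r)].

Lemma card_residue_hit n m : 0 < n -> 0 < m -> coprime n m ->
  minn (totient n) m <= 7 * #|[set r : 'I_m | residue_hit n m r]|.
Proof.
move=> n0 m0 nm; set A := [set r | _].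
pose N (r : 'I_m) := \sum_(a < n) (coprime n a && (a %% m == r)).
have NA r : r \notin A -> N r = 0.
  rewrite inE => /existsPn h; rewrite /N big1// => a _.
  by rewrite (negPf (h a)).
have N1 : \sum_(r in A) N r = totient n.
  transitivity (\sum_r N r).
    by rewrite [RHS](bigID (mem A))/= [X in _ + X]big1 ?addn0// => r /NA.
  rewrite /N exchange_big totient_count_coprime big_mkord/=.
  apply: eq_bigr => a _; rewrite (bigD1 (Ordinal (ltn_pmod a m0)))//= eqxx andbT.
  rewrite big1 ?addn0// => r /negPf nr; rewrite -val_eqE/= in nr.
  by rewrite eq_sym nr andbF.
have N2 : \sum_(r in A) N r ^ 2 <= totient n +
    2 * \sum_(1 <= j < (n %/ m).+1) unit_pairs n (j * m).
  apply: leq_trans (sum_congr_pairs n m0).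
  apply: (@leq_trans (\sum_(r < m) N r ^ 2)).
    by rewrite [leqRHS](bigID (mem A))/= leq_addr.
  rewrite /N; under eq_bigr do rewrite -mulnn big_distrlr/=.
  rewrite exchange_big/=; apply: leq_sum => a _.
  rewrite exchange_big/=; apply: leq_sum => b _.
  rewrite (bigD1 (Ordinal (ltn_pmod a m0)))//= eqxx andbT big1 ?addn0.
    by rewrite [b %% m == _]eq_sym mulnb andbA.
  move=> r /negPf nr; rewrite -val_eqE/= in nr.
  by rewrite [a %% m == r]eq_sym nr andbF.
have := sum_sqr_le_card A N; rewrite N1.
move: N2; set T := \sum_(i in A) _; set S := \sum_(1 <= j < _) _ => N2 CS.
have S1 : m * S <= 3 * totient n ^ 2.
  rewrite -(@leq_pmul2l n)// mulnCA.
  apply: leq_trans (leq_mul (leqnn m) (sum_unit_pairs (n %/ m) n0 nm)) _.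
  have := leq_trunc_div n m; nia.
have t0 : 0 < totient n by rewrite totient_gt0.
move: t0 S1 CS N2; set t := totient n; set c := #|_| => t0 S1 CS N2.
(* Cauchy-Schwarz [t ^ 2 <= c * T] is multiplied by [m], using [m * T <= m * t + 6 * t ^ 2]. After
   cancelling [t], the bracket [m + 6 * t] is at most 7 times the larger of [t] and [m]. *)
have h : t * (t * m) <= t * (c * (m + 6 * t)).
  have := leq_mul (leqnn m) CS; have := leq_mul (leqnn (c * m)) N2; nia.
rewrite leq_pmul2l// in h.
have [tm|mt] := leqP t m.
  by rewrite -(@leq_pmul2r m)//; nia.
by rewrite -(@leq_pmul2l t)//; nia.
Qed.

Local Open Scope classical_set_scope.
Local Open Scope ring_scope.

Lemma expV_nat_lt (F : archiRealFieldType) (p : nat) (e : F) :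
  (1 < p)%N -> 0 < e -> exists k, p%:R ^- k < e.
Proof.
move=> p1 e0; have ei : 0 < e^-1 by rewrite invr_gt0.
exists (Num.truncn e^-1).+1; rewrite -[ltRHS]invrK.
rewrite ltf_pV2 ?posrE ?exprn_gt0 ?ltr0n ?(ltnW p1)//.
apply: lt_trans (truncnS_gt e^-1) _.
by rewrite -natrX ltr_nat ltn_expl.
Qed.

(** * The p-adic absolute value *)

Section PadicAbs.
Variable p : nat.
Hypothesis p_prime : prime p.
Implicit Types x y z : padic p.
Local Notation Q := {ideal_quot (@pnull_pred p)}.
Local Open Scope quotient_scope.

Lemma padic_abs_value x : x != 0 ->
  exists a b : nat, padic_abs x = (p ^ a)%:R / (p ^ b)%:R.
Proof.
elim/quotW: (x : Q) => u u0; have [[nu _]|[c0 [N hN]]] := padic_absP u.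
  by move: u0; rewrite padic_eq0 => /asboolPn.
move: c0; rewrite -(hN N (leqnn N)) /rat_pabs; case: eqP => _; first by rewrite ltxx.
by eexists; eexists.
Qed.

(** A late term of a Cauchy sequence representing [x] is close to [x]. *)
Lemma padic_dense x (e : rat) : 0 < e ->
  exists q : rat, padic_abs (x - ratr q) <= e.
Proof.
move=> e0; elim/quotW: (x : Q) => u.
have [N hN] := @pcauchy_seqP _ u _ e0; exists (pcauchy_val u N).
pose v := PCauchySeq (asboolT (@pcauchy_cst p (pcauchy_val u N))).
have -> : ratr (pcauchy_val u N) = \pi_Q v :> padic p.
  by rewrite -(fmorph_eq_rat (@padic_of_rat p)).
have := padic_absP (u - v); rewrite rmorphB => -[[_ ->]|[_ [M hM]]]; first exact: ltW.
rewrite -(hM (maxn M N) (leq_maxl _ _)).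
have -> : pcauchy_val (u - v) (maxn M N) = u (maxn M N) - u N by [].
by apply/ltW/hN; rewrite ?leq_maxr.
Qed.

Lemma padic_absB_le x y z (e : rat) :
  padic_abs (x - y) <= e -> padic_abs (y - z) <= e -> padic_abs (x - z) <= e.
Proof.
move=> xy yz; rewrite -(subrKA y); apply: le_trans (padic_absD _ _) _.
by rewrite ge_max xy.
Qed.

Lemma padic_absBC x y : padic_abs (x - y) = padic_abs (y - x).
Proof. by rewrite -padic_absN opprB. Qed.

Lemma padic_abs_int (a : int) :
  padic_abs (a%:~R : padic p) = rat_pabs p a%:~R.
Proof. by rewrite -padic_abs_rat ratr_int. Qed.

Let p1 : (1 < p)%N := prime_gt1 p_prime.
Let p0 : (0 < p)%N := prime_gt0 p_prime.
Let pX0 k : 0 < p%:R ^- k :> rat.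
Proof. by rewrite invr_gt0 exprn_gt0// ltr0n. Qed.

Lemma padic_abs_int_le (a : int) k :
  (padic_abs (a%:~R : padic p) <= p%:R ^- k) = (p ^ k %| `|a|)%N.
Proof.
rewrite padic_abs_int; have [->|a0] := eqVneq a 0.
  by rewrite rat_pabs0 dvdn0 ltW.
rewrite -[a%:~R]divr1 -[1]/(1%:~R) rat_pabsE// logn1 expn0 div1r.
rewrite lef_pV2 ?posrE ?ppart_gt0 ?exprn_gt0 ?ltr0n//.
by rewrite -natrX ler_nat leq_exp2l// pfactor_dvdn// absz_gt0.
Qed.

Lemma padic_abs_int_le1 (a : int) : padic_abs (a%:~R : padic p) <= 1.
Proof. by have := padic_abs_int_le a 0; rewrite expr0 invr1 dvd1n. Qed.

Lemma padic_abs_nat_le1 (n : nat) : padic_abs (n%:R : padic p) <= 1.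
Proof. exact: (padic_abs_int_le1 n). Qed.

Lemma padic_abs_natB_le (i j k : nat) :
  (padic_abs (i%:R - j%:R : padic p) <= p%:R ^- k) = (i == j %[mod p ^ k])%N.
Proof.
rewrite -[i%:R]/((i%:Z)%:~R) -[j%:R]/((j%:Z)%:~R) -intrB padic_abs_int_le.
wlog ij : i j / (j <= i)%N.
  move=> h; have [ij|/ltnW ji] := leqP j i; first exact: h.
  by rewrite -abszN opprB h// eq_sym.
by rewrite eqn_mod_dvd// subzn.
Qed.

Lemma padic_abs_unit (n : nat) : coprime p n -> padic_abs (n%:R : padic p) = 1.
Proof.
move=> cpn; have n0 : (0 < n)%N.
  by case: n cpn => //; rewrite /coprime gcdn0 => /eqP h; move: p1; rewrite h.
rewrite -[n%:R]/((n%:Z)%:~R) padic_abs_int -[_%:~R]divr1 -[1]/(1%:~R) rat_pabsE//.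
  have /negPf pn : ~~ (p %| n)%N by rewrite -prime_coprime.
  by rewrite /= logn1 lognE p_prime n0 pn expn0 divr1.
by rewrite -absz_gt0.
Qed.

Lemma padic_absX_p k : padic_abs (p%:R ^+ k : padic p) = p%:R ^- k.
Proof.
rewrite -natrX -[_%:R]/(((p ^ k)%N%:Z)%:~R) padic_abs_int -[_%:~R]divr1.
rewrite -[1]/(1%:~R) rat_pabsE//.
  by rewrite logn1 expn0 div1r/= pfactorK// natrX.
by rewrite -absz_gt0/= expn_gt0 p0.
Qed.

Lemma padic_abs_div (n : nat) x : coprime p n ->
  padic_abs (x / n%:R) = padic_abs x.
Proof.
move=> cpn; have n0 : n%:R != 0 :> padic p.
  by apply: contra_eq_neq (padic_abs_unit cpn) => ->; rewrite padic_abs0 lt_eqF.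
by rewrite -{2}(divfK n0 x) [RHS]padic_absM padic_abs_unit// mulr1.
Qed.

Lemma padic_nat_neq0 (n : nat) : (0 < n)%N -> n%:R != 0 :> padic p.
Proof.
move=> n0; apply/eqP => /(congr1 (@padic_abs p)).
rewrite -[n%:R]/((n%:Z)%:~R) padic_abs0 padic_abs_int => /eqP; apply/negP.
by rewrite gt_eqF// rat_pabs_gt0// intr_eq0 -absz_gt0.
Qed.

(** A rational [q] close to [x] has absolute value at most 1, so its denominator is prime to [p] and
    has an inverse [v] modulo [p ^ k] by Bezout; [i] is the residue of [q] modulo [p ^ k]. *)
Lemma padic_int_approx k x : padic_abs x <= 1 ->
  exists2 i : nat, (i < p ^ k)%N & padic_abs (x - i%:R) <= p%:R ^- k.
Proof.
move=> x1; have [q xq] := padic_dense x (pX0 k).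
have pk1 : p%:R ^- k <= 1 :> rat.
  by rewrite invf_le1 ?exprn_ege1 ?exprn_gt0 ?ltr0n ?ler1n.
have q1 : rat_pabs p q <= 1.
  rewrite -padic_abs_rat -[ratr q](subrK x); apply: le_trans (padic_absD _ _) _.
  by rewrite ge_max x1 padic_absBC (le_trans xq).
have cq : coprime p `|denq q|.
  rewrite prime_coprime//; apply/negP => pd; move: q1; rewrite /rat_pabs.
  have q0 : q != 0.
    by apply: contraTneq pd => ->; rewrite /= dvdn1; apply/eqP => h; move: p1; rewrite h.
  have nq : logn p `|numq q| = 0%N.
    apply/eqP; rewrite -leqn0 leqNgt logn_gt0 mem_primes p_prime/=.
    rewrite absz_gt0 numq_eq0 q0/=; apply/negP => pn.
    have := coprime_num_den q; rewrite /coprime => /eqP g1.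
    have : (p %| gcdn `|numq q| `|denq q|)%N by rewrite dvdn_gcd pn.
    by rewrite g1 dvdn1 => /eqP h; move: p1; rewrite h.
  rewrite (negPf q0) nq expn0 divr1 leNgt => /negP; apply.
  rewrite -[1]/(1%N%:R) ltr_nat -(expn0 p) ltn_exp2l// logn_gt0 mem_primes p_prime pd.
  by rewrite absz_gt0 denq_eq0.
have [[u v]/= uv] : exists uv, uv.1 * (p ^ k)%N%:Z + uv.2 * denq q = 1.
  by apply/coprimezP; rewrite coprimezE/= coprimeXl.
pose m : int := (v * numq q %% (p ^ k)%N%:Z)%Z.
have pk0 : (p ^ k)%N%:Z != 0 by rewrite -absz_gt0/= expn_gt0 p0.
have m0 : 0 <= m by exact: modz_ge0.
have mE : m = `|m|%N by rewrite gez0_abs.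
exists `|m|%N.
  by rewrite -ltz_nat -mE ltz_pmod// ltz_nat expn_gt0 p0.
apply: padic_absB_le xq _.
have -> : ratr q - `|m|%N%:R = ratr (q - m%:~R) :> padic p.
  by rewrite -!(fmorph_eq_rat (@padic_of_rat p)) [RHS]rmorphB [in RHS]mE rmorph_nat.
rewrite padic_abs_rat -{1}(divq_num_den q).
have d0 : (denq q)%:~R != 0 :> rat by rewrite intr_eq0 denq_eq0.
have -> : (numq q)%:~R / (denq q)%:~R - m%:~R =
    (numq q - m * denq q)%:~R / (denq q)%:~R :> rat.
  by rewrite intrB intrM mulrBl mulfK.
have [->|z0] := eqVneq (numq q - m * denq q) 0.
  by rewrite mul0r rat_pabs0 ltW.
rewrite rat_pabsE ?denq_eq0//.
have -> : logn p `|denq q| = 0%N.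
  apply/eqP; rewrite -leqn0 leqNgt logn_gt0 mem_primes p_prime absz_gt0 denq_eq0/=.
  by rewrite -prime_coprime.
rewrite expn0 div1r lef_pV2 ?posrE ?ppart_gt0 ?exprn_gt0 ?ltr0n//.
rewrite -natrX ler_nat leq_exp2l// -pfactor_dvdn ?absz_gt0//.
suff : ((p ^ k)%N%:Z %| numq q - m * denq q)%Z by [].
have mdef := divz_eq (v * numq q) (p ^ k)%N%:Z; rewrite -/m in mdef.
move: mdef; set c := (_ %/ _)%Z => mdef.
apply/dvdzP; exists (u * numq q + c * denq q).
have -> : numq q - m * denq q =
    (u * (p ^ k)%N%:Z + v * denq q) * numq q - m * denq q by rewrite uv mul1r.
rewrite mulrDl -[v * _ * _]mulrAC mdef; ring.
Qed.

(** The nonzero values of the absolute value are integral powers of [p], so a real radius can be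
    rounded down to the largest [p ^ -k] below it, given by the least such [k]. *)
Lemma real_radius (R : realType) (r : R) : 0 < r -> r <= 1 ->
  exists k : nat, forall x, (ratr (padic_abs x) <= r) = (padic_abs x <= p%:R ^- k).
Proof.
move=> r0 r1.
have exk : exists k : nat, p%:R ^- k <= r.
  by have [k /ltW kr] := expV_nat_lt p1 r0; exists k.
case: (ex_minnP exk) => k kr kmin; exists k => x.
have E (n : nat) : ratr (p%:R ^- n : rat) = p%:R ^- n :> R.
  by rewrite rmorphV/= ?unitfE ?expf_neq0 ?pnatr_eq0 -?lt0n// rmorphXn/= ratr_nat.
apply/idP/idP => [xr|xk]; last first.
  by apply: le_trans kr; rewrite -E ler_rat.
case: k kr kmin => [_ _|k kr kmin].
  by rewrite expr0 invr1 -(ler_rat R) rmorph1 (le_trans xr).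
have [->|x0] := eqVneq x 0; first by rewrite padic_abs0 ltW.
have [a [b xE]] := padic_abs_value x0.
have : ratr (padic_abs x) < ratr (p%:R ^- k : rat) :> R.
  apply: le_lt_trans xr _; rewrite E ltNge; apply/negP => /kmin.
  by rewrite ltnn.
have X0 n : 0 < (p ^ n)%:R :> rat by rewrite ltr0n expn_gt0 p0.
rewrite ltr_rat xE -!natrX ltr_pdivrMr// mulrC ltr_pdivlMr// ler_pdivrMr//.
rewrite [leRHS]mulrC ler_pdivlMr// -!natrM !ltr_nat !ler_nat -!expnD.
by rewrite ltn_exp2l// leq_exp2l//; lia.
Qed.

End PadicAbs.

(** * Balls and Haar measure *)

Definition pball (p k : nat) (c : padic p) : set (padic p) :=
  [set x | padic_abs (x - c) <= p%:R ^- k].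

Section PadicBalls.
Variable p : nat.
Hypothesis p_prime : prime p.
Implicit Types (x y z c : padic p) (A : set (padic p)).

Let p1 : (1 < p)%N := prime_gt1 p_prime.
Let p0 : (0 < p)%N := prime_gt0 p_prime.

Lemma ppow_gt0 k : 0 < p%:R ^- k :> rat.
Proof. by rewrite invr_gt0 exprn_gt0// ltr0n. Qed.

Lemma ppow_le j k : (j <= k)%N -> p%:R ^- k <= p%:R ^- j :> rat.
Proof.
move=> jk; rewrite lef_pV2 ?posrE ?exprn_gt0 ?ltr0n//.
by rewrite ler_weXn2l// ler1n.
Qed.

Lemma pball_center k c : pball k c c.
Proof. by rewrite /pball/= subrr padic_abs0 ltW// ppow_gt0. Qed.

Lemma pball_sub j k x c : (j <= k)%N -> pball j c x -> pball k x `<=` pball j c.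
Proof.
move=> jk cx y /= xy; apply: padic_absB_le cx.
exact: le_trans xy (ppow_le jk).
Qed.

Lemma pballC k x c : pball k c x -> pball k x c.
Proof. by rewrite /pball/= padic_absBC. Qed.

Lemma pball_eq k x c : pball k c x -> pball k x = pball k c.
Proof. by move=> cx; apply/seteqP; split; apply: pball_sub => //; exact: pballC. Qed.

Lemma pball00 : pball 0 0 = padic_int p.
Proof. by apply/seteqP; split => x; rewrite /pball/padic_int/= subr0 expr0 invr1. Qed.

Lemma pball_nested j k c d : (j <= k)%N ->
  pball j c `&` pball k d = pball k d \/ pball j c `&` pball k d = set0.
Proof.
move=> jk; have [->|/set0P[x [cx dx]]] := eqVneq (pball j c `&` pball k d) set0.
  by right.
by left; apply/setIidr; rewrite -(pball_eq dx); exact: pball_sub.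
Qed.

Lemma pball_open k c : open (pball k c).
Proof.
rewrite openE => x cx; apply/nbhs_ballP; exists (p%:R ^- k); first exact: ppow_gt0.
move=> y; rewrite ballEmdist/= => xy; apply: padic_absB_le cx.
by rewrite padic_absBC ltW.
Qed.

Lemma pball_measurable k c : @measurable _ (borel_padic p) (pball k c).
Proof. by apply: sub_sigma_algebra; exact: pball_open. Qed.

Lemma padic_int_measurable : @measurable _ (borel_padic p) (padic_int p).
Proof. by rewrite -pball00; exact: pball_measurable. Qed.

(** Two balls are nested or disjoint, so adding [set0] makes the family stable under intersection;
    [setT] supplies the cover used for uniqueness of measures. *)
Definition pball_system : set (set (borel_padic p)) :=
  [set A | [\/ A = setT, A = set0 | exists k c, A = pball k c]].

(** An open set is the union of the balls with rational centre that it contains, and [pickle]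
    enumerates these. *)
Lemma borel_padicE : @measurable _ (borel_padic p) = <<s pball_system >>.
Proof.
apply/seteqP; split; last first.
  apply: smallest_sub; first exact: sigma_algebra_measurable.
  move=> A [->|->|[k [c ->]]]; [exact: measurableT|exact: measurable0|].
  exact: pball_measurable.
apply: smallest_sub; first exact: smallest_sigma_algebra.
move=> U oU.
pose F n := if @unpickle (rat * nat)%type n is Some (q, k) then
  (if `[< pball k (ratr q) `<=` U >] then pball k (ratr q : padic p) else set0)
  else set0.
have -> : U = \bigcup_n F n.
  apply/seteqP; split => [x Ux|x [n _]]; last first.
    rewrite /F; case: unpickle => [[q k]|//]; case: asboolP => //.
    by move=> h xq; exact: h.
  have : nbhs x U by move: oU; rewrite openE; apply.
  move=> /nbhs_ballP[e /= e0 xeU].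
  have [k ke] := expV_nat_lt p1 e0.
  have [q xq] := padic_dense x (ppow_gt0 k).
  have yU : pball k (ratr q) `<=` U.
    rewrite -(@pball_eq _ x)// => y xy; apply: xeU; rewrite ballEmdist/=.
    by rewrite /mdist/= /padic_dist padic_absBC (le_lt_trans xy).
  exists (pickle (q, k)); first exact: I.
  by rewrite /F pickleK asboolT.
have [_ _ sG] := smallest_sigma_algebra setT pball_system.
apply: sG => n; rewrite /F.
have G0 : <<s pball_system >> set0 by apply: sub_sigma_algebra; apply: Or32.
case: unpickle => [[q k]|//]; case: asboolP => // _.
by apply: sub_sigma_algebra; apply: Or33; exists k, (ratr q).
Qed.

Lemma pball_system_setI : setI_closed pball_system.
Proof.
move=> A B [->|->|[j [c ->]]]; first by rewrite setTI.
  by rewrite set0I => _; apply: Or32.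
move=> [->|->|[k [d ->]]]; first by rewrite setIT; apply: Or33; exists j, c.
  by rewrite setI0; apply: Or32.
wlog jk : j k c d / (j <= k)%N.
  move=> h; have [jk|/ltnW kj] := leqP j k; first exact: h.
  by rewrite setIC; exact: h.
by have [->|->] := pball_nested c d jk; [apply: Or33; exists k, d|apply: Or32].
Qed.

(** Restricted to Z_p the measures are finite, and agreement on an intersection-stable generating
    family suffices. A ball of radius at most 1 lies in Z_p if its centre does and misses Z_p
    otherwise, so only centres in Z_p matter. *)
Lemma padic_measure_unique (R : realType)
    (nu1 nu2 : {measure set (borel_padic p) -> \bar R}) :
  (nu1 (padic_int p) < +oo)%E ->
  (forall k c, padic_abs c <= 1 -> nu1 (pball k c) = nu2 (pball k c)) ->
  forall A : set (borel_padic p), measurable A -> A `<=` padic_int p ->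
  nu1 A = nu2 A.
Proof.
move=> fin h A mA AZ; have mZ := padic_int_measurable.
have hZ : nu1 (padic_int p) = nu2 (padic_int p).
  by rewrite -pball00; apply: h; rewrite padic_abs0.
have -> : nu1 A = mrestr nu1 mZ A by rewrite /mrestr setIidl.
have -> : nu2 A = mrestr nu2 mZ A by rewrite /mrestr setIidl.
apply: (measure_unique pball_system (fun=> setT)) mA.
- exact: borel_padicE.
- exact: pball_system_setI.
- by move=> _; apply: Or31.
- by rewrite bigcup_const.
- move=> _ [->|->|[k [c ->]]]; rewrite /= /mrestr ?setTI ?set0I ?measure0//.
  have [c1|c1] := leP (padic_abs c) 1.
    rewrite setIidl; first exact: h.
    rewrite -pball00; apply: pball_sub => //.
    by rewrite /pball/= subr0 expr0 invr1.
  rewrite (_ : _ `&` _ = set0) ?measure0//; apply/seteqP; split => // x [xc x1].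
  have : padic_abs c <= 1; last by rewrite leNgt c1.
  have := pball_sub (leq0n k) (_ : pball 0 0 x) (pballC xc).
  by rewrite pball00 => /(_ x1).
- by move=> _; rewrite /= /mrestr setTI.
Qed.

End PadicBalls.

(** * Haar measure of balls, affine images and thickenings *)

Section Haar.
Variables (R : realType) (p : nat).
Hypothesis p_prime : prime p.
Variable mu : {measure set (borel_padic p) -> \bar R}.
Hypothesis mu_haar : padic_haar mu.

Let p1 : (1 < p)%N := prime_gt1 p_prime.
Let p0 : (0 < p)%N := prime_gt0 p_prime.

(** The zoom that carries the ball of radius [p ^ -j] about [c] onto Z_p; sets are transported by
    preimage. *)
Definition paffine (j : nat) (c x : padic p) : padic p := (x - c) / p%:R ^+ j.

Let pj0 j : p%:R ^+ j != 0 :> padic p.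
Proof. by rewrite expf_neq0// padic_nat_neq0. Qed.

Lemma paffine_pball j c k d :
  paffine j c @^-1` pball k d = pball (k + j) (c + p%:R ^+ j * d).
Proof.
apply/funext => x; rewrite /pball/paffine/=.
have -> : x - (c + p%:R ^+ j * d) = p%:R ^+ j * ((x - c) / p%:R ^+ j - d).
  by rewrite mulrBr [X in _ = X - _]mulrC divfK// opprD addrA.
by rewrite padic_absM padic_absX_p// exprD invfM (mulrC (p%:R ^- k)) ler_pM2l// ppow_gt0.
Qed.

Lemma paffine_measurable j c : measurable_fun setT (paffine j c : borel_padic p -> borel_padic p).
Proof.
apply: (@measurability _ _ (borel_padic p) (borel_padic p) setT _ (@pball_system p)).
  exact: borel_padicE.
move=> _ [_ [->|->|[k [d ->]]] <-]; rewrite setTI.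
- by rewrite preimage_setT; exact: measurableT.
- by rewrite preimage_set0; exact: measurable0.
- by rewrite paffine_pball; exact: pball_measurable.
Qed.

Lemma paffine_measurable_preimage j c (A : set (borel_padic p)) : measurable A ->
  @measurable _ (borel_padic p) (paffine j c @^-1` A).
Proof. by move=> mA; rewrite -[X in measurable X]setTI; exact: paffine_measurable. Qed.

Lemma paffine0_preimage c (A : set (padic p)) :
  paffine 0 c @^-1` A = [set c + y | y in A].
Proof.
apply/seteqP; split => x.
  rewrite /paffine/= expr0 divr1 => Ax; exists (x - c) => //.
  by rewrite addrC subrK.
by move=> [y Ay <-]; rewrite /paffine/= expr0 divr1 addrC addKr.
Qed.

Lemma haar_translate c (A : set (borel_padic p)) : measurable A ->
  mu (paffine 0 c @^-1` A) = mu A.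
Proof. by move=> mA; rewrite paffine0_preimage mu_haar.1. Qed.

Lemma haar_padic_int : mu (padic_int p) = 1%E.
Proof. exact: mu_haar.2. Qed.

(** The balls of radius [p ^ -k] about 0, ..., [p ^ k - 1] are the residue classes modulo [p ^ k]
    and partition Z_p. *)
Lemma padic_partition (nu : {measure set (borel_padic p) -> \bar R}) k
    (A : set (borel_padic p)) : measurable A -> A `<=` padic_int p ->
  nu A = (\sum_(i < p ^ k) nu (A `&` pball k (i%:R : padic p)))%E.
Proof.
move=> mA AZ.
pose F (i : nat) : set (borel_padic p) := A `&` pball k (i%:R : padic p).
have mF i : measurable (F i).
  by apply: measurableI => //; exact: pball_measurable.
have AE : A = \big[setU/set0]_(i < p ^ k) F i.
  rewrite -bigcup_mkord; apply/seteqP; split => [x Ax|x [i _ []//]].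
  by have [i ik xi] := padic_int_approx p_prime k (AZ _ Ax); exists i.
rewrite {1}AE (@measure_semi_additive_ord _ _ _ nu _ (fun i => F i))//; last first.
  by rewrite -AE.
apply/trivIsetP => i j _ _ ij; apply/eqP; apply: contraNT ij => /set0P[x [[_ xi] [_ xj]]].
rewrite -val_eqE/= -(modn_small (ltn_ord i)) -(modn_small (ltn_ord j)).
rewrite -(padic_abs_natB_le p_prime); apply: padic_absB_le xj.
exact: pballC.
Qed.

(** Balls of equal radius are translates of one another, and [p ^ k] of them partition Z_p. *)
Lemma haar_pball k c : mu (pball k c) = (p%:R ^- k)%:E.
Proof.
have E d : mu (pball k d) = mu (pball k (0 : padic p)).
  rewrite -(haar_translate d (pball_measurable p_prime k 0)).
  by rewrite paffine_pball addn0 mulr0 addr0.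
have mZ := padic_int_measurable p_prime.
have le1 : (mu (pball k (0%R : padic p)) <= 1)%E.
  rewrite -haar_padic_int; apply: le_measure; rewrite ?inE//.
    exact: pball_measurable.
  by rewrite -pball00; apply: pball_sub => //; exact: pball_center.
rewrite E; have := padic_partition mu k mZ (@subset_refl _ _).
under eq_bigr => i _.
  rewrite setIidr; last first.
    rewrite -pball00; apply: pball_sub => //.
    by rewrite pball00; exact: padic_abs_nat_le1.
  rewrite E; over.
have pk0 : (p ^ k)%:R != 0 :> R by rewrite pnatr_eq0 -lt0n expn_gt0 p0.
rewrite haar_padic_int -[mu _]fineK ?ge0_fin_numE ?(le_lt_trans le1) ?ltry//.
rewrite sumEFin sumr_const card_ord => -[h]; congr EFin.
by apply: (mulIf pk0); rewrite mulr_natr -h -natrX mulVf.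
Qed.

Lemma haar_le1 (A : set (borel_padic p)) : measurable A -> A `<=` padic_int p ->
  (mu A <= 1)%E.
Proof.
move=> mA AZ; rewrite -haar_padic_int; apply: le_measure => //; rewrite inE//.
exact: padic_int_measurable.
Qed.

Lemma haar_fin_num (A : set (borel_padic p)) : measurable A -> A `<=` padic_int p ->
  mu A \is a fin_num.
Proof. by move=> mA AZ; rewrite ge0_fin_numE// (le_lt_trans (haar_le1 mA AZ))// ltry. Qed.

(** In [A], the two sides are a pushforward and a multiple of [mu]; as measures they need only be
    compared on balls. *)
Lemma haar_affine j c (A : set (borel_padic p)) : measurable A -> A `<=` padic_int p ->
  (mu (paffine j c @^-1` A) = (p%:R ^- j)%:E * mu A)%E.
Proof.
move=> mA AZ.
have pj : 0 <= p%:R ^- j :> R by rewrite invr_ge0 exprn_ge0.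
pose phi_mixin := isMeasurableFun.Build _ _ _ _ _ (paffine_measurable j c).
pose phi : {mfun borel_padic p >-> borel_padic p} := HB.pack (paffine j c) phi_mixin.
apply: (@padic_measure_unique p p_prime R (pushforward mu phi) (mscale (NngNum pj) mu)) => //.
  rewrite /= /pushforward -pball00 paffine_pball haar_pball.
  by rewrite ltry.
move=> k d _; rewrite /= /pushforward /mscale/= paffine_pball !haar_pball.
by rewrite exprD invfM EFinM muleC.
Qed.

Lemma padic_set1E (c : padic p) : [set c] = \bigcap_k pball k c.
Proof.
apply/seteqP; split => [_ -> k _|x xc]; first exact: pball_center.
apply/eqP; rewrite -subr_eq0; apply/eqP; apply: padic_abs_eq0; apply/eqP.
rewrite eq_le padic_abs_ge0 andbT leNgt; apply/negP => h.
have [k hk] := expV_nat_lt p1 h.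
by have := xc k I; rewrite /pball/= leNgt hk.
Qed.

Lemma measurable_padic_set1 c : @measurable _ (borel_padic p) [set c].
Proof.
rewrite padic_set1E; apply: bigcap_measurableType => k _.
exact: pball_measurable.
Qed.

(* The measures of [V] in the balls of radius [p^-j] are at most [p^-j * mu V] and
   add up to [mu V], so all are equal: [V] is independent of every ball, hence of
   itself. *)
Lemma haar_zero_one (V : set (borel_padic p)) : measurable V ->
  V `<=` padic_int p ->
  (forall j i : nat, (i < p ^ j)%N ->
     V `&` pball j (i%:R : padic p) `<=` paffine j i%:R @^-1` V) ->
  mu V = 0%E \/ mu V = 1%E.
Proof.
move=> mV VZ hV; pose v := fine (mu V).
have vE : mu V = v%:E by rewrite /v fineK// haar_fin_num.
have v0 : 0 <= v by rewrite fine_ge0.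
have ub j i : (i < p ^ j)%N ->
    (mu (V `&` pball j (i%:R : padic p)) <= (p%:R ^- j * v)%:E)%E.
  move=> ij; rewrite EFinM -vE -(haar_affine j i%:R mV VZ).
  apply: le_measure; rewrite ?inE; last exact: hV.
  - by apply: measurableI => //; exact: pball_measurable.
  - exact: paffine_measurable_preimage.
have eq j (i : 'I_(p ^ j)) : mu (V `&` pball j (i%:R : padic p)) = (p%:R ^- j * v)%:E.
  pose a (i : nat) := fine (mu (V `&` pball j (i%:R : padic p))).
  have aE (i' : nat) : mu (V `&` pball j (i'%:R : padic p)) = (a i')%:E.
    rewrite /a fineK// haar_fin_num//; last by move=> x [/VZ].
    by apply: measurableI => //; exact: pball_measurable.
  have := padic_partition mu j mV VZ; under eq_bigr do rewrite aE.
  rewrite sumEFin vE => -[sE]; rewrite aE; congr EFin.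
  have : \sum_(i < p ^ j) (p%:R ^- j * v - a i) = 0.
    rewrite sumrB -sE sumr_const card_ord -[_ *+ _]mulr_natr natrX mulrAC mulVf ?mul1r ?subrr//.
    by rewrite expf_neq0// pnatr_eq0 -lt0n.
  move/eqP; rewrite psumr_eq0 => [/allP|i' _].
    by move=> /(_ i (mem_index_enum _)); rewrite /= subr_eq0 => /eqP ->.
  by rewrite subr_ge0 -lee_fin -aE ub.
have : mu V = (v%:E * mu V)%E.
  transitivity (mrestr mu mV V); first by rewrite /mrestr setIid.
  apply: (@padic_measure_unique p p_prime R (mrestr mu mV) (mscale (NngNum v0) mu)) => //.
    rewrite /= /mrestr setIC (setIidl VZ) vE; exact: ltry.
  move=> k c c1; rewrite /= /mrestr /mscale/= haar_pball.
  have [i ik ci] := padic_int_approx p_prime k c1.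
  by rewrite setIC (pball_eq p_prime ci) (eq k (Ordinal ik)) EFinM muleC.
rewrite vE -EFinM => -[/eqP].
rewrite -subr_eq0 -{1}[v]mulr1 -mulrBr mulf_eq0 => /orP[/eqP ->|]; first by left.
by rewrite subr_eq0 => /eqP <-; right.
Qed.

(** For [x] in [T] and a nearby [y] in [D], write [x - y = p ^ l * w] and let [i] be the residue of
    [w] modulo [p ^ t]. Then [x - i * p ^ l] is within [p ^ -(l + t)] of [y], hence in [D]: the
    [p ^ t] translates of [D] by the [i * p ^ l] cover [T]. *)
Lemma haar_thicken (k l t : nat) (D T : set (borel_padic p)) :
  (k <= l + t)%N -> measurable D -> measurable T ->
  (forall x, D x -> pball k (x : padic p) `<=` D) ->
  (forall x, T x -> exists2 y, D y & pball l (y : padic p) x) ->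
  (mu T <= (p ^ t)%:R%:E * mu D)%E.
Proof.
move=> klt mD mT Dk TD.
pose F (i : nat) : set (borel_padic p) := paffine 0 ((i * p ^ l)%:R) @^-1` D.
have mF i : measurable (F i) by exact: paffine_measurable_preimage.
have TF : T `<=` \big[setU/set0]_(i < p ^ t) F i.
  rewrite -bigcup_mkord => x /TD[y Dy yx].
  have wE : x - y = p%:R ^+ l * ((x - y) / p%:R ^+ l) by rewrite mulrC divfK.
  set w := _ / _ in wE.
  have w1 : padic_abs w <= 1.
    rewrite -(@ler_pM2l _ (p%:R ^- l)) ?ppow_gt0// mulr1.
    by rewrite -{1}padic_absX_p// -padic_absM -wE.
  have [i it wi] := padic_int_approx p_prime t w1.
  exists i => //; apply: (Dk y Dy); rewrite /pball/paffine/= expr0 divr1.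
  have -> : x - (i * p ^ l)%:R - y = p%:R ^+ l * (w - i%:R).
    by rewrite mulrBr -wE natrM natrX [_%:R * _]mulrC addrAC.
  rewrite padic_absM padic_absX_p//; apply: le_trans (ppow_le p_prime klt).
  by rewrite exprD invfM ler_pM2l// ppow_gt0.
apply: (le_trans (content_subadditive _ (fun k _ => mF k) mT TF)).
rewrite (eq_bigr (fun=> mu D)) => [|i _]; last exact: haar_translate.
by rewrite sumr_const card_ord mule_natl.
Qed.

End Haar.

(** * Approximation sets at a fixed level *)

Definition reduced_num (n : nat) : set int :=
  [set a : int | - n%:Z <= a <= n%:Z /\ gcdz a n%:Z = 1].

(** K_n with its radius replaced by [p ^ -k]. When [p] does not divide [n] and [psi n > 0], K_n
    always has this form, so dilations become shifts of an integer level; a higher level means a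
    smaller set. *)
Definition approx_level (p n k : nat) : set (padic p) :=
  \bigcup_(a in reduced_num n) [set x | padic_int p x /\ pball k (a%:~R / n%:R) x].

Lemma reduced_num1 n : (0 < n)%N -> reduced_num n 1.
Proof. by move=> n0; split; [lia|rewrite /gcdz/= gcd1n]. Qed.

Section ApproxSets.
Variables (R : realType) (p : nat).
Hypothesis p_prime : prime p.
Implicit Types (psi : nat -> R) (x y : padic p).

Let p1 : (1 < p)%N := prime_gt1 p_prime.
Let p0 : (0 < p)%N := prime_gt0 p_prime.

Lemma ratr_ppow n : ratr (p%:R ^- n : rat) = p%:R ^- n :> R.
Proof.
by rewrite rmorphV/= ?unitfE ?expf_neq0 ?pnatr_eq0 -?lt0n// rmorphXn/= ratr_nat.
Qed.

Lemma approx_set_int psi n : approx_set p psi n `<=` padic_int p.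
Proof. by move=> x [a _ []]. Qed.

Lemma approx_level_int n k : approx_level n k `<=` padic_int p.
Proof. by move=> x [a _ []]. Qed.

Lemma padic_disc_measurable c (r : R) :
  @measurable _ (borel_padic p) [set x : padic p | ratr (padic_abs (x - c)) <= r].
Proof.
have [r0|r0|<-] := ltgtP 0 r.
- apply: sub_sigma_algebra.
  have [k kr] := expV_nat_lt p1 r0.
  rewrite openE => x /= xr; apply: (@filterS _ _ _ (pball k x)).
    move=> y /= yx; have /orP[] : (padic_abs (y - c) <= padic_abs (y - x)) ||
        (padic_abs (y - c) <= padic_abs (x - c)).
      rewrite -le_max; rewrite -(subrKA x); exact: padic_absD.
      move=> h; apply: le_trans (ltW kr); rewrite -ratr_ppow ler_rat.
      exact: le_trans yx.
    by move=> h; apply: le_trans xr; rewrite ler_rat.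
  have := @pball_open p p_prime k x; rewrite openE; apply.
  exact: pball_center.
- rewrite (_ : [set _ | _] = set0); first exact: measurable0.
  apply/seteqP; split => // x /= h.
  have : 0 <= (ratr (padic_abs (x - c)) : R) by rewrite ler0q padic_abs_ge0.
  by rewrite leNgt (le_lt_trans h r0).
- rewrite (_ : [set _ | _] = [set c]); first exact: measurable_padic_set1.
  apply/seteqP; split => x /=; last by move=> ->; rewrite subrr padic_abs0 rmorph0.
  rewrite -(rmorph0 (@ratr R)) ler_rat => h.
  apply/eqP; rewrite -subr_eq0; apply/eqP; apply: padic_abs_eq0.
  by apply/le_anti; rewrite h padic_abs_ge0.
Qed.

Lemma approx_set_measurable psi n : @measurable _ (borel_padic p) (approx_set p psi n).
Proof.
rewrite /approx_set bigcup_mkcond; apply: countable_bigcupT_measurable => // a.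
case: ifP => _; last exact: measurable0.
apply: (@measurableI _ (borel_padic p)); first exact: padic_int_measurable.
exact: padic_disc_measurable.
Qed.

Lemma approx_level_measurable n k : @measurable _ (borel_padic p) (approx_level n k).
Proof.
rewrite /approx_level bigcup_mkcond; apply: countable_bigcupT_measurable => // a.
case: ifP => _; last exact: measurable0.
apply: (@measurableI _ (borel_padic p)); first exact: padic_int_measurable.
exact: pball_measurable.
Qed.

(** A reduced fraction whose denominator is divisible by [p] has absolute value above 1, so all
    points of Z_p are equally far from it. *)
Lemma approx_set_dvd psi n : (0 < n)%N -> (p %| n)%N ->
  approx_set p psi n = set0 \/ approx_set p psi n = padic_int p.
Proof.
move=> n0 pn; have [->|/set0P[x [a ra [x1 xa]]]] := eqVneq (approx_set p psi n) set0.
  by left.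
right; apply/seteqP; split => [|y y1]; first exact: approx_set_int.
exists a => //; split => //; apply: le_trans xa; rewrite ler_rat.
have xa1 : 1 < padic_abs (x - a%:~R / n%:R).
  rewrite ltNge; apply/negP => h.
  have : padic_abs (a%:~R / n%:R : padic p) <= 1.
    by rewrite -[_ / _]subr0; apply: (@padic_absB_le _ _ x); rewrite ?subr0// padic_absBC.
  move=> h1; have : padic_abs (a%:~R : padic p) <= p%:R ^- 1.
    rewrite -[a%:~R](divfK (padic_nat_neq0 p n0)) padic_absM.
    rewrite -[leRHS]mul1r ler_pM ?padic_abs_ge0//.
    by rewrite -[n%:R]/((n%:Z)%:~R) padic_abs_int_le// expn1.
  rewrite padic_abs_int_le// expn1 => pa; have : (p %| gcdn `|a| n)%N by rewrite dvdn_gcd pa.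
  by case: ra => _; rewrite /gcdz => -[->]; rewrite dvdn1 => /eqP h'; move: p1; rewrite h'.
have -> : y - a%:~R / n%:R = (y - x) + (x - a%:~R / n%:R) by rewrite addrA subrK.
apply: le_trans (padic_absD _ _) _; rewrite ge_max lexx andbT.
apply: le_trans (ltW xa1).
by apply: (@padic_absB_le _ y 0); rewrite ?subr0// sub0r padic_absN.
Qed.

Lemma padic_frac_int (a : int) n : coprime p n -> padic_int p (a%:~R / n%:R).
Proof. by move=> pn; rewrite /padic_int/= padic_abs_div// padic_abs_int_le1. Qed.

Lemma pball_int k c : padic_int p c -> pball k c `<=` padic_int p.
Proof. by rewrite -pball00 => c1; exact: pball_sub. Qed.

Lemma approx_level0 n : (0 < n)%N -> coprime p n -> approx_level n 0 = padic_int p.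
Proof.
move=> n0 pn; apply/seteqP; split=> [|x x1]; first exact: approx_level_int.
exists 1; first exact: reduced_num1.
split => //; rewrite (pball_eq p_prime (_ : pball 0 0 _)) pball00//.
exact: padic_frac_int.
Qed.

(** A radius up to 1 is rounded by [real_radius]; a larger one gives all of Z_p, which is level 0.
    The inequality records that rounding does not increase the radius. *)
Lemma approx_set_levelE psi n : (0 < n)%N -> coprime p n -> 0 < psi n ->
  exists k, approx_set p psi n = approx_level n k /\ p%:R ^- k <= psi n / n%:R.
Proof.
move=> n0 pn psi0; have n0R : 0 < n%:R :> R by rewrite ltr0n.
have [psi1|psi1] := leP (psi n / n%:R) 1.
  have [k hk] := real_radius p_prime (divr_gt0 psi0 n0R) psi1.
  exists k; split; last first.
    (* The equivalence of the two radii is tested at the point [p ^ k]. *)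
    by rewrite -ratr_ppow -(padic_absX_p p_prime) hk padic_absX_p.
  rewrite /approx_set /approx_level; apply: eq_bigcupr => a _.
  by apply/funext => x /=; rewrite /pball/= hk.
exists 0; split; last by rewrite expr0 invr1 ltW.
rewrite approx_level0//; apply/seteqP; split => [|x x1].
  exact: approx_set_int.
exists 1; first exact: reduced_num1.
split => //; apply: le_trans (ltW psi1); rewrite -(rmorph1 (@ratr R)) ler_rat.
have := pball_eq p_prime (_ : pball 0 0 (1%:~R / n%:R)); rewrite pball00.
by move=> /(_ (padic_frac_int _ pn)) e; move: x1; rewrite -e /pball/= expr0 invr1.
Qed.

End ApproxSets.

(** * Measure of the approximation sets at a fixed level *)

Section LevelBounds.
Variables (R : realType) (p : nat).
Hypothesis p_prime : prime p.
Variable mu : {measure set (borel_padic p) -> \bar R}.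
Hypothesis mu_haar : padic_haar mu.

Let p1 : (1 < p)%N := prime_gt1 p_prime.
Let p0 : (0 < p)%N := prime_gt0 p_prime.

Let mB k (c : padic p) : @measurable _ (borel_padic p) (pball k c).
Proof. exact: pball_measurable. Qed.

(** The centres are [a / n] and [- (a / n)] with [0 <= a <= n] coprime to [n]. There are at most
    [2 * totient n] such [a], where the 2 absorbs the endpoint [a = n], which counts only for
    [n = 1]. *)
Lemma approx_level_le n k : (0 < n)%N ->
  (mu (approx_level n k) <= (4 * (totient n)%:R / p%:R ^+ k)%:E)%E.
Proof.
move=> n0; pose F (a : nat) : set (borel_padic p) := if coprime n a then
  pball k (a%:R / n%:R : padic p) `|` pball k (- (a%:R / n%:R) : padic p) else set0.
have mF a : measurable (F a).
  rewrite /F; case: ifP => _; last exact: measurable0.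
  by apply: measurableU; exact: mB.
have EF : approx_level n k `<=` \big[setU/set0]_(a < n.+1) F a.
  rewrite -bigcup_mkord => x [a [an /eqP ga] [_ xa]]; exists `|a|%N => /=; first lia.
  rewrite /F coprime_sym ifT; last by move: ga; rewrite /gcdz eqz_nat.
  have [a0|a0] := leP 0 a; [left|right].
    by move: xa; rewrite -{1}(gez0_abs a0).
  by move: xa; rewrite -{1}[a]opprK -{1}(ltz0_abs a0) rmorphN mulNr.
have mE := approx_level_measurable p_prime n k.
apply: (le_trans (content_subadditive _ (fun k _ => mF k) mE EF)).
have Fle a : (mu (F a) <= (2 * (coprime n a)%:R / p%:R ^+ k)%:E)%E.
  rewrite /F; case: ifP => _; last by rewrite measure0 mulr0 mul0r.
  have Ble c : (mu (pball k c) <= (p%:R ^- k)%:E)%E by rewrite (haar_pball p_prime mu_haar).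
  apply: le_trans (measureU2 _ (mB _ _) (mB _ _)) _.
  by apply: le_trans (leeD (Ble _) (Ble _)) _; rewrite -EFinD lee_fin mulr1 mulr_natl mulr2n.
apply: (@le_trans _ _ (\sum_(a < n.+1) (2 * (coprime n a)%:R / p%:R ^+ k)%:E)%E).
  by apply: lee_sum => a _; exact: Fle.
rewrite sumEFin lee_fin -mulr_suml -mulr_sumr -natr_sum ler_wpM2r ?invr_ge0 ?exprn_ge0//.
rewrite big_ord_recr/= -(big_mkord xpredT (fun a => coprime n a : nat)) -totient_count_coprime.
rewrite -!natrM ler_nat /coprime gcdnn.
have : (0 < totient n)%N by rewrite totient_gt0.
by case: eqP => _; lia.
Qed.

(** Division by [n] preserves distances, so numerators in distinct classes modulo [p ^ k] give
    disjoint balls. The classes that are hit are counted by [card_residue_hit], whence the 7. *)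
Lemma approx_level_ge n k : (0 < n)%N -> coprime p n ->
  (((minn (totient n) (p ^ k))%:R / (7 * p%:R ^+ k))%:E <= mu (approx_level n k))%E.
Proof.
move=> n0 pn; set m := (p ^ k)%N; have m0 : (0 < m)%N by rewrite expn_gt0 p0.
pose F (r : nat) : set (borel_padic p) :=
  if residue_hit n m r then pball k (r%:R / n%:R : padic p) else set0.
have mF r : measurable (F r).
  by rewrite /F; case: ifP => _; [exact: mB|exact: measurable0].
have FE : \big[setU/set0]_(r < m) F r `<=` approx_level n k.
  rewrite -bigcup_mkord => x [r /= rm]; rewrite /F.
  case: ifP => // /existsP[a /andP[na /eqP ar]] xr.
  exists (a%:Z); first split.
  - by have := ltn_ord a; lia.
  - by rewrite /gcdz/= gcdnC; move: na => /eqP ->.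
  have ra : pball k ((a%:Z)%:~R / n%:R) (r%:R / n%:R : padic p).
    rewrite /pball/= -mulrBl padic_abs_div//.
    by rewrite (padic_abs_natB_le p_prime) -ar modn_mod.
  have xa : pball k ((a%:Z)%:~R / n%:R) x by rewrite -(pball_eq p_prime ra).
  split => //; move: xa; apply: pball_int => //.
  exact: padic_frac_int.
have mE := approx_level_measurable p_prime n k.
have mUF : measurable (\big[setU/set0]_(r < m) F r).
  by rewrite -bigcup_mkord; apply: fin_bigcup_measurable.
suff h : (((minn (totient n) m)%:R / (7 * p%:R ^+ k))%:E <=
    mu (\big[setU/set0]_(r < m) F r))%E.
  by apply: (le_trans h); apply: le_measure; rewrite ?inE.
have -> : mu (\big[setU/set0]_(r < m) F r) = (\sum_(r < m) mu (F r))%E.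
  apply: (@measure_semi_additive_ord _ _ _ mu _ (fun i => F i)) => //.
  apply/trivIsetP => i j _ _ ij; apply/eqP; apply: contraNT ij => /set0P[x []].
  rewrite /F; case: ifP => // _ xi; case: ifP => // _ xj.
  rewrite -val_eqE/= -(modn_small (ltn_ord i)) -(modn_small (ltn_ord j)).
  rewrite -(padic_abs_natB_le p_prime) -(padic_abs_div p_prime _ pn) mulrBl.
  by apply: padic_absB_le xj; exact: pballC.
have -> : (\sum_(r < m) mu (F r) = \sum_(r < m) (((residue_hit n m r)%:R : R) / p%:R ^+ k)%:E)%E.
  apply: eq_bigr => r _; rewrite /F; case: ifP => _; last by rewrite measure0 mul0r.
  by rewrite (haar_pball p_prime mu_haar) mul1r.
rewrite sumEFin lee_fin -mulr_suml invfM mulrA ler_wpM2r ?invr_ge0 ?exprn_ge0//.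
rewrite ler_pdivrMr// mulrC -natr_sum -[7]/(7%N%:R) -natrM ler_nat.
have nm : coprime n m by rewrite coprime_sym coprimeXl.
apply: leq_trans (card_residue_hit n0 m0 nm) _.
rewrite leq_mul2l/= -sum1_card big_mkcond/=; apply: leq_sum => r _.
by rewrite inE; case: residue_hit.
Qed.

(** Combining the upper bound at level [k] with the lower bound at level [k - t] loses [28 = 4 * 7].
    If [totient n > p ^ (k - t)], the dilated set is saturated, with measure at least 1/7; if
    [k < t], truncated subtraction gives level 0, which is Z_p. *)
Lemma approx_level_shrink n k t : (0 < n)%N -> coprime p n ->
  (mine 1 ((p ^ t)%:R%:E * mu (approx_level n k)) <=
   28%:R%:E * mu (approx_level n (k - t)%N))%E.
Proof.
move=> n0 pn; have [tk|kt] := leqP t k; last first.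
  have -> : (k - t = 0)%N by lia.
  rewrite approx_level0// (haar_padic_int mu_haar) mule1 ge_min.
  by rewrite lee_fin ler1n.
have Pk j : 0 < p%:R ^+ j :> R by rewrite exprn_gt0// ltr0n.
apply: (@le_trans _ _ (4 * (minn (totient n) (p ^ (k - t)))%:R / p%:R ^+ (k - t))%:E); last first.
  have := approx_level_ge (k - t) n0 pn.
  rewrite -(@lee_pmul2l _ 28%:R%:E)// ?lte_fin// -EFinM; apply: le_trans.
  rewrite lee_fin le_eqVlt; apply/orP; left; apply/eqP.
  by field; rewrite gt_eqF.
rewrite ge_min; have [tm|mt] := leqP (totient n) (p ^ (k - t)); apply/orP; [right|left].
  apply: le_trans (lee_wpmul2l _ (approx_level_le k n0)) _; first by rewrite lee_fin.
  rewrite -EFinM lee_fin natrX -[in leLHS](subnK tk) exprD le_eqVlt.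
  by apply/orP; left; apply/eqP; field; rewrite !gt_eqF.
by rewrite lee_fin natrX mulfK ?gt_eqF// ler1n.
Qed.

Lemma approx_level_pball n k (x y : padic p) : pball k x y -> approx_level n k x ->
  approx_level n k y.
Proof.
move=> xy [a ra [x1 xa]]; exists a => //; split.
  by apply: pball_int xy.
by rewrite -(pball_eq p_prime xa).
Qed.

(* Sorting the points by the smallest level at which they are covered makes the
   pieces disjoint, and a point stays within reach of its piece since lower
   levels are dilated more. *)
Lemma haar_dilate (S : set nat) (kappa : nat -> nat) t :
  (forall n, S n -> (0 < n)%N /\ coprime p n) ->
  (mu (\bigcup_(n in S) approx_level n (kappa n - t)%N) <=
   (p ^ t)%:R%:E * mu (\bigcup_(n in S) approx_level n (kappa n)))%E.
Proof.
move=> hS.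
have mU (kap : nat -> nat) (S' : set nat) : @measurable _ (borel_padic p)
    (\bigcup_(n in S') approx_level n (kap n)).
  by apply: bigcup_measurable => n _; exact: approx_level_measurable.
pose D k : set (borel_padic p) := \bigcup_(n in [set n | S n /\ kappa n = k]) approx_level n k.
have mD k : measurable (D k) by exact: mU.
have Dk j k x y : (j <= k)%N -> pball k (x : padic p) y -> D j x -> D j y.
  move=> jk xy [n nS nx]; exists n => //; apply: approx_level_pball nx.
  by apply: pball_sub jk (pball_center p_prime _ _) _ xy.
have UD : \bigcup_(n in S) approx_level n (kappa n) = \bigcup_k D k.
  apply/seteqP; split => [x [n nS nx]|x [k _ [n [nS <-]]] nx].
    by exists (kappa n) => //; exists n.
  by exists n.
pose T k : set (borel_padic p) := \bigcup_(y in seqDU D k) pball (k - t) (y : padic p).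
have mT k : measurable (T k).
  by apply: sub_sigma_algebra; apply: bigcup_open => y _; exact: pball_open.
have UT : \bigcup_(n in S) approx_level n (kappa n - t) `<=` \bigcup_k T k.
  move=> x [n nS [a ra [x1 xa]]]; have [n0 pn] := hS n nS.
  have Dy : exists k, `[< D k (a%:~R / n%:R) >] && (k <= kappa n)%N.
    exists (kappa n); rewrite leqnn andbT; apply/asboolP; exists n => //; exists a => //.
    by split; [exact: padic_frac_int|exact: pball_center].
  case: (ex_minnP Dy) => k /andP[/asboolP Dk' kn] kmin.
  exists k => //; exists (a%:~R / n%:R); last first.
    by apply: pball_sub xa; [|lia|exact: pball_center].
  split => //; rewrite -bigcup_mkord => -[j /= jk Dj].
  have : (k <= j)%N by apply: kmin; rewrite asboolT//=; lia.
  by rewrite leqNgt jk.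
have mDU := seqDU_measurable mD.
apply: (le_trans (measure_sigma_subadditive mu mT (mU _ _) UT)).
apply: (@le_trans _ _ (\sum_(k <oo) (p ^ t)%:R%:E * mu (seqDU D k))%E).
  apply: lee_nneseries => [*|k *]; first exact: measure_ge0.
  apply: (haar_thicken p_prime mu_haar (k := k) (l := k - t)) => //; first lia.
  (* Removing the lower levels from [D k] leaves a union of balls of radius [p ^ -k], because each
     lower [D j] is itself stable under moves of that size. *)
  - move=> x [Dx nDx] y xy; split; first exact: (Dk _ _ _ _ (leqnn k) xy).
    rewrite -bigcup_mkord => -[j /= jk Dj]; apply: nDx; rewrite -bigcup_mkord.
    by exists j => //; apply: (Dk _ _ _ _ (ltnW jk) _ Dj); exact: pballC.
rewrite nneseriesZl//.
rewrite UD seqDU_bigcup_eq.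
rewrite (measure_bigcup mu setT _ (fun i _ => mDU i) (@trivIset_seqDU _ D)).
by under [in leRHS]eq_eseriesl do rewrite in_setT.
Qed.

End LevelBounds.

(** * Full limsup sets *)

Section Divergence.
Variables (R : realType) (p : nat).
Hypothesis p_prime : prime p.
Variable mu : {measure set (borel_padic p) -> \bar R}.
Hypothesis mu_haar : padic_haar mu.
Implicit Types psi : nat -> R.

Let p1 : (1 < p)%N := prime_gt1 p_prime.
Let p0 : (0 < p)%N := prime_gt0 p_prime.

Let mK psi n : @measurable _ (borel_padic p) (approx_set p psi n).
Proof. exact: approx_set_measurable. Qed.

(** For [n = 0] only [a = 0] is in range, and [gcdz 0 0 = 0]; hence sums and unions may start at 0
    or at 1. *)
Lemma approx_set0 psi : approx_set p psi 0 = set0.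
Proof.
apply/seteqP; split => // x [a [a0 ga] _]; move: a0 ga; rewrite oppr0 => /le_anti <-.
by [].
Qed.

Lemma approx_limsupE psi : approx_limsup p psi = lim_sup_set (approx_set p psi).
Proof.
apply/seteqP; split => x h m _.
  have [n /= mn xn] := h (maxn m 1) (leq_maxr _ _).
  by exists n => //=; move: mn; rewrite geq_max => /andP[].
by have [n /= mn xn] := h m I; exists n.
Qed.

Lemma approx_limsup_measurable psi :
  @measurable _ (borel_padic p) (approx_limsup p psi).
Proof.
rewrite approx_limsupE; apply: bigcap_measurableType => n _.
by apply: bigcup_measurable => k _; exact: mK.
Qed.

Lemma approx_limsup_int psi : approx_limsup p psi `<=` padic_int p.
Proof. by move=> x /(_ 1 isT)[n _ /approx_set_int]. Qed.

Lemma approx_set_le psi phi n : psi n <= phi n ->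
  approx_set p psi n `<=` approx_set p phi n.
Proof.
move=> le x [a ra [x1 xa]]; exists a => //; split => //; apply: le_trans xa _.
by rewrite ler_wpM2r.
Qed.

(** The set lies in every [approx_level n k], whose measure tends to 0 with growing [k]. *)
Lemma approx_set_null psi n : (0 < n)%N -> psi n = 0 -> mu (approx_set p psi n) = 0%E.
Proof.
move=> n0 psi0; apply/eqP; rewrite eq_le measure_ge0 andbT.
apply/lee_addgt0Pr => e e0; rewrite add0e.
have t0 : 0 < 4 * (totient n)%:R :> R by rewrite mulr_gt0// ltr0n totient_gt0.
have [k hk] := expV_nat_lt p1 (divr_gt0 e0 t0).
apply: (@le_trans _ _ (mu (approx_level n k))); last first.
  apply: le_trans (approx_level_le p_prime mu_haar k n0) _.
  by rewrite lee_fin mulrC -ler_pdivlMr// ltW.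
apply: le_measure; rewrite ?inE; [exact: mK|exact: approx_level_measurable|].
move=> x [a ra [x1 xa]]; exists a => //; split => //; rewrite /pball/=.
rewrite -(ler_rat R); apply: le_trans xa _; rewrite psi0 mul0r ratr_ppow//.
Qed.

Lemma approx_set_dvd0 psi n : (0 < n)%N -> (p %| n)%N -> psi n = 0 ->
  approx_set p psi n = set0.
Proof.
move=> n0 pn psi0; have [//|h] := approx_set_dvd p_prime psi n0 pn.
have := approx_set_null n0 psi0; rewrite h (haar_padic_int mu_haar).
by move=> /eqP; rewrite onee_eq0.
Qed.

Lemma approx_series0 psi :
  (\sum_(1 <= n <oo) mu (approx_set p psi n) = \sum_(n <oo) mu (approx_set p psi n))%E.
Proof.
rewrite eseries_cond eseries_mkcond; apply: eq_eseriesr => -[|n] _ //=.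
by rewrite approx_set0 measure0.
Qed.

Lemma approx_series_tail psi N :
  (\sum_(1 <= n <oo) mu (approx_set p psi n) = +oo)%E ->
  (\sum_(N <= n <oo) mu (approx_set p psi n) = +oo)%E.
Proof.
rewrite approx_series0 (nneseries_split 0 N); last by move=> *; exact: measure_ge0.
rewrite add0n; set S := (\sum_(0 <= k < N) _)%E.
have Sfin : S \is a fin_num.
  rewrite sum_fin_num; apply/allP => _ /mapP[k _ ->] /=.
  by apply: (haar_fin_num p_prime mu_haar); [exact: mK|exact: approx_set_int].
by case: (\sum_(N <= k <oo) _)%E; case: S Sfin.
Qed.

(** By the Borel-Cantelli lemma a convergent series would make the limsup set null. *)
Lemma haar_limsup_eq1 psi : mu (approx_limsup p psi) = 1%E ->
  (\sum_(1 <= n <oo) mu (approx_set p psi n) = +oo)%E.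
Proof.
rewrite approx_limsupE => mu1; apply/eqP/negPn/negP => h.
have : (\sum_(n <oo) mu (approx_set p psi n) < +oo)%E.
  by rewrite -approx_series0 ltey.
move=> /(lim_sup_set_cvg0 (mK psi)) /eqP.
by rewrite mu1 onee_eq0.
Qed.

(** Where [psi] vanishes, K_n need not be empty, as it may contain the fractions themselves, but it
    is null. So cutting [psi] off to 0 discards indices up to measure zero. *)
Lemma haar_bigcup_support psi (D : set nat) : (forall n, ~ D n -> psi n = 0) ->
  (mu (\bigcup_(n in [set n : nat | (1 <= n)%N]) approx_set p psi n) <=
   mu (\bigcup_(n in [set n | D n /\ (1 <= n)%N]) approx_set p psi n))%E.
Proof.
move=> hD; pose G := \bigcup_(n in [set n | D n /\ (1 <= n)%N]) approx_set p psi n.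
pose F n : set (borel_padic p) := if `[< D n >] then set0 else approx_set p psi n.
have mF n : measurable (F n).
  by rewrite /F; case: ifP => _; [exact: measurable0|exact: mK].
have mG : @measurable _ (borel_padic p) G.
  by apply: bigcup_measurable => n _; exact: mK.
have mUF : measurable (\bigcup_n F n) by exact: bigcup_measurable.
have F0 : (mu (\bigcup_n F n) <= 0)%E.
  apply: le_trans (measure_sigma_subadditive mu mF mUF (@subset_refl _ _)) _.
  rewrite eseries0// => -[|n] _ _; rewrite /F; case: asboolP => [_|/hD Dn];
    rewrite ?approx_set0 ?measure0//.
  exact: approx_set_null.
apply: (@le_trans _ _ (mu (G `|` \bigcup_n F n))).
  apply: le_measure; rewrite ?inE.
  - by apply: bigcup_measurable => n _; exact: mK.
  - exact: measurableU.
  move=> x [n /= n0 xn]; have [Dn|Dn] := pselect (D n); [left|right]; exists n => //.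
  by rewrite /F asboolF.
apply: (le_trans (measureU2 mu mG mUF)); rewrite -[leRHS]adde0.
exact: leeD.
Qed.

Lemma haar_bigcap_ge (C : R) (F : nat -> set (borel_padic p)) :
  (forall n, measurable (F n)) -> (forall n, F n `<=` padic_int p) ->
  (forall n m, (n <= m)%N -> F m `<=` F n) ->
  (forall n, C%:E <= mu (F n))%E -> (C%:E <= mu (\bigcap_n F n))%E.
Proof.
move=> mF FZ dF CF.
have mI : measurable (\bigcap_n F n) by exact: bigcap_measurableType.
have F0 : (mu (F 0%N) < +oo)%E.
  by rewrite (le_lt_trans (haar_le1 p_prime mu_haar (mF 0%N) (FZ 0%N)))// ltry.
have cvF : mu \o F @ \oo --> mu (\bigcap_n F n).
  by apply: nonincreasing_cvg_mu => // n m nm; apply/subsetPset; exact: dF.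
by apply: (cvge_ge _ cvF); apply: nearW => n; exact: CF.
Qed.

(** * From the uniform lower bound to full measure *)

Section ZeroOne.
Variable psi : nat -> R.
Hypothesis psi_ge0 : forall n, 0 <= psi n.

(** Truncating at [n] keeps the radius at most [p ^ -t], as zooming requires; [M] selects a tail;
    multiples of [p], whose sets are empty or all of Z_p, are left out. *)
Definition shrink (t M n : nat) : R :=
  if (M <= n)%N && coprime p n then Num.min (psi n) n%:R / p%:R ^+ t else 0.

Lemma shrink_ge0 t M n : 0 <= shrink t M n.
Proof.
rewrite /shrink; case: ifP => // _.
by rewrite divr_ge0 ?exprn_ge0// le_min psi_ge0 ler0n.
Qed.

Lemma shrink_le t M n : shrink t M n <= psi n.
Proof.
rewrite /shrink; case: ifP => // _; rewrite ler_pdivrMr ?exprn_gt0 ?ltr0n//.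
rewrite ge_min; apply/orP; left.
by rewrite ler_peMr// exprn_ege1// ler1n.
Qed.

Lemma shrink_anti s t M n : (s <= t)%N -> shrink t M n <= shrink s M n.
Proof.
move=> st; rewrite /shrink; case: ifP => // _.
rewrite ler_wpM2l ?le_min ?psi_ge0 ?ler0n// lef_pV2 ?posrE ?exprn_gt0 ?ltr0n//.
by rewrite ler_weXn2l// ler1n.
Qed.

(** If the original set is level [k], the shrunk one contains level [k + t]; dilating this single
    set back to level [k] costs at most [p ^ t]. *)
Lemma approx_set_shrink_le t M n : (0 < n)%N -> (M <= n)%N -> coprime p n ->
  (mu (approx_set p psi n) <=
   (p ^ t)%:R%:E * mu (approx_set p (shrink t M) n))%E.
Proof.
move=> n0 Mn pn; have n0R : 0 < n%:R :> R by rewrite ltr0n.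
have [psi0|psi0] := eqVneq (psi n) 0.
  by rewrite approx_set_null// mule_ge0.
have psi_gt0 : 0 < psi n by rewrite lt_neqAle eq_sym psi0 psi_ge0.
have [k [-> kle]] := approx_set_levelE p_prime n0 pn psi_gt0.
apply: (@le_trans _ _ ((p ^ t)%:R%:E * mu (approx_level n (k + t)))%E).
  have := @haar_dilate R p p_prime mu mu_haar [set n] (fun=> (k + t)%N) t.
  rewrite !bigcup_set1 addnK; apply.
  by move=> _ ->.
apply: lee_wpmul2l; first by rewrite lee_fin.
apply: le_measure; rewrite ?inE; [exact: approx_level_measurable|exact: mK|].
move=> x [a ra [x1 xa]]; exists a => //; split => //.
rewrite /shrink Mn pn/= mulrAC.
apply: (@le_trans _ _ (p%:R ^- (k + t))); first by rewrite -ratr_ppow// ler_rat.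
rewrite exprD invfM ler_wpM2r ?invr_ge0 ?exprn_ge0//.
have [le|lt] := leP (psi n) n%:R => //.
by rewrite divff ?gt_eqF// invf_le1 ?exprn_gt0 ?ltr0n// exprn_ege1// ler1n.
Qed.

Lemma shrink_series t M M0 : (forall n, (M0 <= n)%N -> (0 < n)%N -> (p %| n)%N ->
    approx_set p psi n = set0) ->
  (\sum_(1 <= n <oo) mu (approx_set p psi n) = +oo)%E ->
  (\sum_(1 <= n <oo) mu (approx_set p (shrink t M) n) = +oo)%E.
Proof.
move=> hM0 soo; set N := maxn (maxn M M0) 1.
have := approx_series_tail N soo.
have : (\sum_(N <= n <oo) mu (approx_set p psi n) <=
  (p ^ t)%:R%:E * \sum_(N <= n <oo) mu (approx_set p (shrink t M) n))%E.
  rewrite -nneseriesZl// eseries_cond [leRHS]eseries_cond.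
  apply: lee_nneseries => [*|n /= Nn]; first exact: measure_ge0.
  move: Nn; rewrite !geq_max => /andP[/andP[Mn M0n] n0].
  have [pn|] := boolP (coprime p n); first exact: approx_set_shrink_le.
  rewrite prime_coprime// negbK => pn.
  by rewrite hM0// measure0 mule_ge0.
move=> le e; move: le; rewrite e leye_eq => /eqP.
rewrite approx_series0 (nneseries_split 0 N); last by move=> *; exact: measure_ge0.
rewrite add0n; set T := (\sum_(N <= n <oo) _)%E.
have T0 : (0 <= T)%E by apply: nneseries_ge0.
case: T T0 => [r| |]// _ _.
by rewrite addey// gt_eqF// (@lt_le_trans _ _ 0%E)// sume_ge0.
Qed.

(* Zooming in on a ball of radius [p^-j] multiplies the distances by [p^j] and
   keeps the numerators in the range [-n, n]. *)
Lemma shrink_zoom (j i t n : nat) (x : padic p) : (0 < n)%N -> (i < p ^ j)%N ->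
  pball j (i%:R) x -> approx_set p (shrink (t + j) 0) n x ->
  approx_set p (shrink t 0) n (paffine j i%:R x).
Proof.
move=> n0 ij xi [a [/andP[an na] ga] [x1 xa]].
have n0R : 0 < n%:R :> R by rewrite ltr0n.
have P0 : (0 < p ^ j)%N by rewrite expn_gt0 p0.
have pj0 : p%:R ^+ j != 0 :> padic p by rewrite expf_neq0// padic_nat_neq0.
have [pn|] := boolP (coprime p n); last first.
  rewrite prime_coprime// negbK => pn.
  have : approx_set p (shrink (t + j) 0) n x.
    by exists a; [split => //; apply/andP|].
  rewrite approx_set_dvd0// /shrink /=; case: ifP => //.
  by rewrite prime_coprime// pn.
have nn0 : n%:R != 0 :> padic p by rewrite padic_nat_neq0.
have shrinkD : shrink (t + j) 0 n = shrink t 0 n / p%:R ^+ j.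
  by rewrite /shrink pn/= exprD invfM mulrA.
(* The truncation in [shrink] bounds the radius by [p ^ -j], so [a / n] lies in the ball about [i];
   that is, [a] is congruent to [i * n] modulo [p ^ j]. *)
have xaj : padic_abs (x - a%:~R / n%:R) <= p%:R ^- j.
  rewrite -(ler_rat R) ratr_ppow//; apply: le_trans xa _.
  rewrite shrinkD mulrAC ler_piMl ?invr_ge0 ?exprn_ge0// ler_pdivrMr// mul1r.
  rewrite /shrink pn/= ler_pdivrMr ?exprn_gt0 ?ltr0n//.
  by rewrite ge_min; apply/orP; right; rewrite ler_peMr// exprn_ege1// ler1n.
have : padic_abs ((a - i%:Z * n%:Z)%:~R : padic p) <= p%:R ^- j.
  rewrite -(padic_abs_div p_prime _ pn) intrB intrM mulrBl mulfK//.
  by apply: padic_absB_le xi; rewrite padic_absBC.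
rewrite padic_abs_int_le// => /dvdnP[c cE].
have /dvdzP[b bE] : ((p ^ j)%N%:Z %| a - i%:Z * n%:Z)%Z by rewrite dvdzE/= cE dvdn_mull.
have aE : a = i%:Z * n%:Z + b * (p ^ j)%N%:Z by rewrite -bE addrC subrK.
exists b.
  split; last first.
    have : gcdz (b * (p ^ j)%N%:Z) n%:Z = 1.
      by rewrite -ga aE gcdzC [RHS]gcdzC gcdzMDl.
    move/eqP; rewrite -[_ == _]/(coprimez _ _) coprimezMl => /andP[/eqP + _]; exact.
  (* From [0 <= i < P] and [-n <= a <= n] follows [- P * n <= a - i * n <= n], and [b] is the middle
     term divided by [P]. *)
  by move: aE an na ij P0; set P := (p ^ j)%N => aE an na iP P0; apply/andP; split; nia.
have yb : paffine j i%:R x - b%:~R / n%:R = (x - a%:~R / n%:R) / p%:R ^+ j.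
  apply: (mulIf pj0); rewrite divfK// mulrBl /paffine divfK// aE.
  rewrite intrD !intrM mulrDl mulfK// opprD addrA; congr (_ - _).
  by rewrite -natrX mulrAC.
split.
  rewrite /padic_int/=; have : pball 0 0 (paffine j i%:R x).
    rewrite -[pball 0 0 _]/((paffine j i%:R @^-1` pball 0 0) x) paffine_pball//.
    by rewrite add0n mulr0 addr0.
  by rewrite pball00.
rewrite yb; move: xa; rewrite shrinkD mulrAC.
set u := x - _.
have -> : padic_abs u = padic_abs (u / p%:R ^+ j) * p%:R ^- j.
  by rewrite -padic_absX_p// -padic_absM divfK.
rewrite rmorphM/= ratr_ppow//.
by rewrite ler_pM2r// invr_gt0 exprn_gt0// ltr0n.
Qed.

Definition shrink_limsup t : set (borel_padic p) :=
  approx_limsup p (shrink t 0).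

(** A zoom by [p ^ j] sends the limsup set for [t + j] into the one for [t]; the intersection over
    all [t] absorbs this loss. *)
Lemma shrink_limsup_zoom j i : (i < p ^ j)%N ->
  (\bigcap_t shrink_limsup t) `&` pball j (i%:R : padic p) `<=`
  paffine j i%:R @^-1` \bigcap_t shrink_limsup t.
Proof.
move=> ij x [xV xi] t _ m m1.
have [n /= mn xn] := xV (t + j)%N I m m1.
by exists n => //; apply: shrink_zoom => //; exact: leq_trans mn.
Qed.

Lemma haar_limsup_full (C : R) : 0 < C ->
  (forall phi : nat -> R, (forall n, 0 <= phi n) ->
    (C%:E * mine (\sum_(1 <= n <oo) mu (approx_set p phi n)) 1
     <= mu (\bigcup_(n in [set n : nat | (1 <= n)%N]) approx_set p phi n))%E) ->
  (\sum_(1 <= n <oo) mu (approx_set p psi n) = +oo)%E ->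
  mu (approx_limsup p psi) = 1%E.
Proof.
move=> C0 quasi soo.
have mW := approx_limsup_measurable psi.
(* If infinitely many multiples of [p] have a nonempty set, these sets equal Z_p and so does the
   limsup set. Otherwise the multiples of [p] are eventually negligible. *)
have [[M0 hM0]|nM] := pselect (exists M0, forall n, (M0 <= n)%N -> (0 < n)%N ->
    (p %| n)%N -> approx_set p psi n = set0); last first.
  rewrite (_ : approx_limsup p psi = padic_int p) ?(haar_padic_int mu_haar)//.
  apply/seteqP; split => [|x x1 m m1]; first exact: approx_limsup_int.
  apply: contrapT => h; apply: nM; exists m => n mn n0 pn.
  have [//|e] := approx_set_dvd p_prime psi n0 pn.
  by case: h; exists n => //; rewrite e.
have mS t : measurable (shrink_limsup t) by exact: approx_limsup_measurable.
have SZ t : shrink_limsup t `<=` padic_int p by exact: approx_limsup_int.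
have mB t (D : set nat) : @measurable _ (borel_padic p)
    (\bigcup_(n in D) approx_set p (shrink t 0) n).
  by apply: bigcup_measurable => n _; exact: mK.
(* The shrunk series diverges along every tail, so the minimum with 1 is 1 and each tail union has
   measure at least [C]; continuity from above does the rest. *)
have SC t : (C%:E <= mu (shrink_limsup t))%E.
  rewrite /shrink_limsup approx_limsupE; apply: haar_bigcap_ge => //.
  - by move=> m x [n _ /approx_set_int].
  - by move=> n m nm x [k /= mk xk]; exists k => //=; exact: leq_trans mk.
  move=> M; have := quasi (shrink t M) (shrink_ge0 t M).
  rewrite (shrink_series t M hM0 soo) (_ : mine +oo 1 = 1)%E; last first.
    by rewrite /mine ltNge leey.
  rewrite mule1 => /le_trans; apply.
  apply: le_trans (haar_bigcup_support (D := [set n | (M <= n)%N]) _) _.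
    by move=> n; rewrite /shrink => /= /negP/negPf ->.
  apply: le_measure; rewrite ?inE; [|exact: mB|].
    by apply: bigcup_measurable => n _; exact: mK.
  move=> x [n /= [Mn n0] xn]; exists n => //.
  by move: xn; rewrite /approx_set /shrink Mn leq0n.
pose V := \bigcap_t shrink_limsup t.
have mV : measurable V by exact: bigcap_measurableType.
have VZ : V `<=` padic_int p by move=> x /(_ 0%N I)/SZ.
have VC : (C%:E <= mu V)%E.
  apply: haar_bigcap_ge => // s t st x xt m m1; have [n mn xn] := xt m m1.
  by exists n => //; apply: approx_set_le xn; exact: shrink_anti.
have V1 : mu V = 1%E.
  have [V0|//] := haar_zero_one p_prime mu_haar mV VZ shrink_limsup_zoom.
  by move: VC; rewrite V0 lee_fin leNgt C0.
apply/eqP; rewrite eq_le (haar_le1 p_prime mu_haar mW (@approx_limsup_int _))/=.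
rewrite -V1; apply: le_measure; rewrite ?inE// => x /(_ 0%N I) xV m m1.
by have [n mn xn] := xV m m1; exists n => //; apply: approx_set_le xn; exact: shrink_le.
Qed.

End ZeroOne.

End Divergence.

(** * Dilating and gluing *)

Section Amplify.
Variables (R : realType) (p : nat).
Hypothesis p_prime : prime p.
Variable mu : {measure set (borel_padic p) -> \bar R}.
Hypothesis mu_haar : padic_haar mu.
Implicit Types psi : nat -> R.

Let p1 : (1 < p)%N := prime_gt1 p_prime.
Let p0 : (0 < p)%N := prime_gt0 p_prime.

Local Notation approx_union psi :=
  (\bigcup_(n in [set n : nat | (1 <= n)%N]) approx_set p psi n).

Let mK psi n : @measurable _ (borel_padic p) (approx_set p psi n).
Proof. exact: approx_set_measurable. Qed.

Lemma approx_union_measurable psi :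
  @measurable _ (borel_padic p) (approx_union psi).
Proof. by apply: bigcup_measurable => n _; exact: mK. Qed.

Lemma approx_union_int psi : approx_union psi `<=` padic_int p.
Proof. by move=> x [n _ /approx_set_int]. Qed.

Lemma exists_expn_scale (m : R) : 0 < m -> m <= 1 ->
  exists t : nat, 1 <= (p ^ t)%:R * m < p%:R.
Proof.
move=> m0 m1; have ext : exists t : nat, 1 <= (p ^ t)%:R * m.
  exists (Num.truncn m^-1).+1; rewrite -ler_pdivrMr// div1r.
  have mi : 0 <= m^-1 by rewrite invr_ge0 ltW.
  apply: (@le_trans _ _ (Num.truncn m^-1).+1%:R); first exact/ltW/truncnS_gt.
  by rewrite ler_nat ltnW// ltn_expl.
case: (ex_minnP ext) => t t1 tmin; exists t; rewrite t1/=.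
case: t t1 tmin => [_ _|t _ tmin].
  by rewrite mul1r (le_lt_trans m1)// ltr1n.
have : (p ^ t)%:R * m < 1 by rewrite ltNge; apply/negP => /tmin; rewrite ltnn.
by rewrite expnS natrM -mulrA => h; rewrite gtr_pMr// ltr0n.
Qed.

(* A family violating the quasi-independence bound with a tiny constant is
   dilated by the power of [p] that brings its total measure to about 1. *)
Lemma haar_amplify (C e : R) (N : nat) psi : (forall n, 0 <= psi n) ->
  0 < C -> C * p%:R <= 1 -> C * p%:R <= e -> C * N%:R <= 2^-1 ->
  (mu (approx_union psi) <
    C%:E * mine (\sum_(1 <= n <oo) mu (approx_set p psi n)) 1)%E ->
  exists2 phi : nat -> R, (forall n, 0 <= phi n) &
    (mu (approx_union phi) <= e%:E)%E /\
    ((56^-1)%:E <= \sum_(N <= n <oo) mu (approx_set p phi n))%E.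
Proof.
move=> psi0 C0 Cp1 Cpe CN bad; set U := approx_union psi in bad.
have mU : @measurable _ (borel_padic p) U by exact: approx_union_measurable.
have KU n : (0 < n)%N -> approx_set p psi n `<=` U by move=> n0 x xn; exists n.
pose u := fine (mu U).
have uE : mu U = u%:E.
  by rewrite /u fineK// (haar_fin_num p_prime mu_haar)//; exact: approx_union_int.
have u0 : 0 <= u by rewrite fine_ge0.
pose f n := fine (mu (approx_set p psi n)).
have fE n : mu (approx_set p psi n) = (f n)%:E.
  by rewrite /f fineK// (haar_fin_num p_prime mu_haar)//; exact: approx_set_int.
have f0 n : 0 <= f n by rewrite fine_ge0.
have mu0 : mu (set0 : set (padic p)) = 0%E by exact: measure0.
have fu n : f n <= u.
  case: n => [|n]; first by rewrite /f approx_set0 mu0.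
  by rewrite -lee_fin -fE -uE; apply: le_measure; rewrite ?inE//; exact: KU.
have C1 : C < 1.
  by rewrite (lt_le_trans _ Cp1)// ltr_pMr// ltr1n.
have ltS : ((u / C)%:E < mine (\sum_(1 <= n <oo) mu (approx_set p psi n)) 1)%E.
  rewrite -(@lte_pmul2l _ C%:E)// -EFinM mulrC divfK ?gt_eqF//.
  by rewrite -uE.
have uC : u < C.
  move: ltS; rewrite lt_min => /andP[_]; rewrite lte_fin ltr_pdivrMr//.
  by rewrite mul1r.
have [M uM] : exists M, u / C < \sum_(0 <= n < M) f n.
  apply: contrapT => h; move: ltS; rewrite lt_min => /andP[+ _].
  rewrite ltNge => /negP; apply; rewrite approx_series0.
  apply: lime_le; first by apply: is_cvg_nneseries => *; exact: measure_ge0.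
  apply: nearW => M; under eq_bigr do rewrite fE.
  by rewrite sumEFin lee_fin leNgt; apply/negP => hM; apply: h; exists M.
set s := \sum_(0 <= n < M) f n in uM.
(* A finite partial sum [s] already witnesses the violation, in the form [u < C * m]; [t] is then
   chosen with [1 <= p ^ t * m < p]. *)
pose m := Num.min s 1.
have um : u < C * m.
  by rewrite -ltr_pdivrMl// mulrC /m lt_min uM/= ltr_pdivrMr// mul1r.
have m0 : 0 < m by rewrite -(pmulr_rgt0 _ C0) (le_lt_trans u0).
have m1 : m <= 1 by rewrite /m ge_min lexx orbT.
have [t /andP[t1 tp]] := exists_expn_scale m0 m1.
pose S : set nat := [set n | [/\ (0 < n)%N, coprime p n & 0 < psi n]].
have [kappa hk] : exists kappa : nat -> nat, forall n, S n ->
    approx_set p psi n = approx_level n (kappa n).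
  have /choice[kappa hk] : forall n, exists k, S n -> approx_set p psi n = approx_level n k.
    move=> n; have [[n0 pn psin]|nS] := pselect (S n); last by exists 0%N.
    by have [k [kE _]] := approx_set_levelE p_prime n0 pn psin; exists k.
  by exists kappa.
have fS n : ~ S n -> f n = 0.
  case: n => [|n] nS; first by rewrite /f approx_set0 mu0.
  have [pn|] := boolP (coprime p n.+1).
    have [/eqP psin|psin] := boolP (psi n.+1 == 0).
      by rewrite /f (approx_set_null p_prime mu_haar).
    by case: nS; split => //; rewrite lt_neqAle eq_sym psin psi0.
  rewrite prime_coprime// negbK => pn.
  (* A set equal to Z_p is excluded, since its measure would be at most [u < C < 1]. *)
  have [e0|e0] := approx_set_dvd p_prime psi (ltn0Sn n) pn.
    by rewrite /f e0 mu0.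
  have := fu n.+1; rewrite /f e0 (haar_padic_int mu_haar)/= => /le_lt_trans/(_ uC).
  by move=> /lt_trans/(_ C1); rewrite ltxx.
pose S' : set nat := [set n | S n /\ (N <= n)%N].
pose phi n : R := if `[< S' n >] then n%:R * p%:R ^- (kappa n - t)%N else 0.
have phiE n : S' n -> approx_set p phi n = approx_level n (kappa n - t)%N.
  move=> S'n; have [[n0 _ _] _] := S'n.
  rewrite /approx_set /approx_level; apply: eq_bigcupr => a _.
  apply/funext => x /=; rewrite /phi asboolT// mulrAC divff ?pnatr_eq0 -?lt0n//.
  by rewrite mul1r -(ratr_ppow R)// ler_rat.
exists phi.
  by move=> n; rewrite /phi; case: ifP => // _; rewrite mulr_ge0// invr_ge0 exprn_ge0.
split.
  apply: le_trans (haar_bigcup_support p_prime mu_haar (D := S') _) _.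
    by move=> n nS; rewrite /phi asboolF.
  rewrite (_ : \bigcup_(n in _) _ = \bigcup_(n in S') approx_level n (kappa n - t)%N); last first.
    apply/seteqP; split => x [n nS xn].
      by exists n; [exact: nS.1|rewrite -phiE//; exact: nS.1].
    by exists n; [split => //; case: nS => -[]|rewrite phiE].
  apply: le_trans (haar_dilate p_prime mu_haar kappa t _) _.
    by move=> n [[]].
  (* The dilated union is bounded through [p ^ t * u <= C * (p ^ t * m) <= C * p <= e]. *)
  apply: (@le_trans _ _ ((p ^ t)%:R%:E * u%:E)%E); last first.
    rewrite -EFinM lee_fin; apply: le_trans Cpe.
    apply: (@le_trans _ _ ((p ^ t)%:R * (C * m))); first by rewrite ler_wpM2l// ltW.
    by rewrite mulrCA ler_wpM2l// ltW.
  apply: lee_wpmul2l; first by rewrite lee_fin.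
  rewrite -uE; apply: le_measure; rewrite ?inE//.
    by apply: bigcup_measurable => n _; exact: approx_level_measurable.
  move=> x [n [nS _] xn]; exists n; first by case: nS.
  by rewrite hk.
have phi_ge n : (N <= n)%N -> (((p ^ t)%:R * f n / 28)%:E <= mu (approx_set p phi n))%E.
  move=> Nn; have [nS|nS] := pselect (S n); last by rewrite fS// mulr0 mul0r.
  have [n0 pn _] := nS; rewrite phiE//.
  have := approx_level_shrink p_prime mu_haar (kappa n) t n0 pn.
  (* No saturation occurs: [p ^ t * f n <= p ^ t * u <= C * p <= 1]. *)
  rewrite -hk// fE -EFinM (_ : mine _ _ = ((p ^ t)%:R * f n)%:E); last first.
    apply/min_idPr; rewrite lee_fin; apply: le_trans Cp1.
    apply: (@le_trans _ _ ((p ^ t)%:R * (C * m))).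
      by rewrite ler_wpM2l// (le_trans (fu n))// ltW.
    by rewrite mulrCA ler_wpM2l// ltW.
  by rewrite -lee_pdivrMl// -EFinM mulrC.
apply: (@le_trans _ _ (\sum_(N <= n < M) ((p ^ t)%:R * f n / 28)%:E)%E); last first.
  apply: (@le_trans _ _ (\sum_(N <= n < M) mu (approx_set p phi n))%E).
    rewrite big_nat_cond [leRHS]big_nat_cond; apply: lee_sum => n /andP[/andP[Nn _] _].
    exact: phi_ge.
  by apply: nneseries_lim_ge => *; exact: measure_ge0.
rewrite sumEFin lee_fin -mulr_suml -mulr_sumr ler_pdivlMr//.
have -> : 56^-1 * 28 = 2^-1 :> R by lra.
(* Each term is at most [u], so the indices below [N] carry at most [N * C * m <= m / 2]. At least
   [m / 2] remains, which explains [56 = 2 * 28]. *)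
have sN : s <= N%:R * u + \sum_(N <= n < M) f n.
  have hN K : \sum_(0 <= n < K) f n <= K%:R * u.
    elim: K => [|K IH]; first by rewrite big_nil mul0r.
    by rewrite big_nat_recr//= -natr1 mulrDl mul1r lerD.
  have [NM|MN] := leqP N M.
    by rewrite /s (@big_cat_nat _ _ _ N)//= lerD.
  rewrite [X in _ + X]big_geq ?addr0 1?ltnW//; apply: le_trans (hN M) _.
  by rewrite ler_wpM2r// ler_nat ltnW.
have ms : m <= s by rewrite /m ge_min lexx.
have : m / 2 <= \sum_(N <= n < M) f n.
  have : N%:R * u <= m / 2.
    apply: (@le_trans _ _ (N%:R * (C * m))); first by rewrite ler_wpM2l// ltW.
    by rewrite mulrA [N%:R * C]mulrC [m / 2]mulrC ler_wpM2r// ltW.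
  lra.
move=> h; apply: (@le_trans _ _ ((p ^ t)%:R * (m / 2))); last by rewrite ler_wpM2l.
by rewrite mulrA -[leLHS]mul1r ler_wpM2r.
Qed.

End Amplify.

Section Glue.
Variables (R : realType) (p : nat).
Hypothesis p_prime : prime p.
Variable mu : {measure set (borel_padic p) -> \bar R}.
Hypothesis mu_haar : padic_haar mu.

Let mK (psi : nat -> R) n : @measurable _ (borel_padic p) (approx_set p psi n).
Proof. exact: approx_set_measurable. Qed.

(** The maximum of the [psi j n] over [j <= n] dominates [psi j] from [j] on, so all tails of its
    series are at least [c] and it diverges. Being finite, the maximum is attained, so the limsup
    set lies in the union of the [U j], whose measures sum to at most 1/2. *)
Lemma haar_glue (c : R) (psi : nat -> nat -> R) : 0 < c ->
  (forall j n, 0 <= psi j n) ->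
  (forall j, (mu (\bigcup_(n in [set n : nat | (1 <= n)%N]) approx_set p (psi j) n)
     <= (2^-1 / (2 ^ j.+1)%:R)%:E)%E) ->
  (forall j, (c%:E <= \sum_(j <= n <oo) mu (approx_set p (psi j) n))%E) ->
  exists2 phi : nat -> R, (forall n, 0 <= phi n) &
    (\sum_(1 <= n <oo) mu (approx_set p phi n) = +oo)%E /\
    (mu (approx_limsup p phi) < 1)%E.
Proof.
move=> c0 psi0 Ule Sge.
pose phi n := \big[Num.max/0]_(j < n.+1) psi j n.
have phiE n : exists j : nat, phi n = psi j n.
  rewrite /phi; have [//|j _ ->] := @eq_bigmax _ _ _ 0 ord0 xpredT (fun j : 'I_n.+1 => psi j n) isT.
    by exists j.
have phi_ge j n : (j <= n)%N -> psi j n <= phi n.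
  move=> jn; rewrite /phi.
  exact: (le_bigmax _ (fun j : 'I_n.+1 => psi j n) (Ordinal (jn : (j < n.+1)%N))).
exists phi; first by move=> n; have [j ->] := phiE n.
split.
  apply/eqP/negPn/negP => h.
  have Sfin : (\sum_(0 <= n <oo) mu (approx_set p phi n) < +oo)%E.
    by rewrite -approx_series0// ltey.
  have tail0 := nneseries_tail_cvg Sfin (fun n _ => measure_ge0 mu _).
  have : (c%:E <= 0)%E; last by rewrite lee_fin leNgt c0.
  apply: cvge_ge tail0; apply: nearW => N; apply: le_trans (Sge N) _.
  rewrite eseries_cond [leRHS]eseries_cond; apply: lee_nneseries => [*|n /= Nn].
    exact: measure_ge0.
  by apply: le_measure; rewrite ?inE//; apply: approx_set_le; exact: phi_ge.
pose U j : set (borel_padic p) :=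
  \bigcup_(n in [set n : nat | (1 <= n)%N]) approx_set p (psi j) n.
have mU j : measurable (U j) by exact: approx_union_measurable.
have WU : approx_limsup p phi `<=` \bigcup_j U j.
  move=> x /(_ 1%N isT)[n /= n1 xn]; have [j jE] := phiE n.
  by exists j => //; exists n => //; apply: approx_set_le xn; rewrite jE.
apply: (@le_lt_trans _ _ (2^-1)%:E); last by rewrite lte_fin invf_lt1// ltr1n.
apply: le_trans (measure_sigma_subadditive mu mU _ WU) _.
  exact: approx_limsup_measurable.
apply: le_trans (epsilon_trick0 xpredT _); last by rewrite invr_ge0.
by apply: lee_nneseries => [*|j _]; [exact: measure_ge0|exact: Ule].
Qed.

End Glue.

Theorem theorem1p10 (R : realType) (p : nat) (p_prime : prime p)
    (mu : {measure set (borel_padic p) -> \bar R}) (mu_haar : padic_haar mu) :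
  (forall psi : nat -> R, (forall n, 0 <= psi n) ->
     (mu (approx_limsup p psi) = 1%E <->
      (\sum_(1 <= n <oo) mu (approx_set p psi n) = +oo)%E))
  <->
  (exists C : R, 0 < C /\
     forall psi : nat -> R, (forall n, 0 <= psi n) ->
       (C%:E * mine (\sum_(1 <= n <oo) mu (approx_set p psi n)) 1
        <= mu (\bigcup_(n in [set n : nat | (1 <= n)%N]) approx_set p psi n))%E).
Proof.
split=> [dich|[C [C0 quasi]] psi psi0]; last first.
  split; first exact: haar_limsup_eq1.
  exact: (haar_limsup_full p_prime mu_haar psi0 C0 quasi).
apply: contrapT => noC.
have bad (C : R) : 0 < C -> exists2 psi : nat -> R, (forall n, 0 <= psi n) &
    (mu (\bigcup_(n in [set n : nat | (1 <= n)%N]) approx_set p psi n) <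
     C%:E * mine (\sum_(1 <= n <oo) mu (approx_set p psi n)) 1)%E.
  move=> C0; apply: contrapT => h; apply: noC; exists C; split=> // psi psi0.
  by rewrite leNgt; apply/negP => lt; apply: h; exists psi.
have pR : 0 < p%:R :> R by rewrite ltr0n prime_gt0.
have /choice[psi hpsi] : forall j : nat, exists psi : nat -> R,
    [/\ forall n, 0 <= psi n,
     (mu (\bigcup_(n in [set n : nat | (1 <= n)%N]) approx_set p psi n)
       <= (2^-1 / (2 ^ j.+1)%:R)%:E)%E &
     ((56^-1)%:E <= \sum_(j <= n <oo) mu (approx_set p psi n))%E].
  move=> j; pose e : R := 2^-1 / (2 ^ j.+1)%:R.
  have e0 : 0 < e by rewrite divr_gt0// ltr0n expn_gt0.
  have e1 : e <= 1.
    rewrite ler_pdivrMr ?ltr0n ?expn_gt0// mul1r.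
    by rewrite (@le_trans _ _ 1) ?invf_le1 ?ler1n// expn_gt0.
  (* The first entry makes [C * p <= e], the size allowed to the [j]-th union; the second makes
     [C * j <= 1 / 2], with [j.+1] to avoid dividing by 0. *)
  pose C := Num.min (e / p%:R) (2^-1 / j.+1%:R).
  have C0 : 0 < C by rewrite lt_min !divr_gt0.
  have Ce : C * p%:R <= e by rewrite -ler_pdivlMr// ge_min lexx.
  have [psi psi0 psib] := bad C C0.
  have [||phi phi0 [U S]] := haar_amplify p_prime mu_haar psi0 C0 _ Ce _ psib (N := j).
  - exact: le_trans Ce e1.
  - apply: (@le_trans _ _ (C * j.+1%:R)); first by rewrite ler_pM2l// ler_nat.
    by rewrite -ler_pdivlMr// ge_min lexx orbT.
  by exists phi.
have [|j n|j|j|phi phi0 [Soo W1]] := @haar_glue R p p_prime mu 56^-1 psi.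
- by rewrite invr_gt0.
- by have [] := hpsi j.
- by have [] := hpsi j.
- by have [] := hpsi j.
(* For this divergent series, (i) would give the limsup set measure 1. *)
by move: W1; rewrite (dich phi phi0).2// ltxx.
Qed.
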